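(* Let $\mathcal{T}=(V,E)$ be a rootless and leafless directed tree and let $S_\lambda$ be a densely defined weighted shift on $\mathcal{T}$ with nonzero weights $\lambda=\{\lambda_v\}_{v\in V}\subseteq\mathbb{C}$. Suppose there exists a system $\{\mu_v\}_{v\in V}$ of Borel probability measures on $\mathbb{R}_+$ such that $$\mu_u(\sigma)=\sum_{v\in\mathrm{Chi}(u)}|\lambda_v|^2\int_\sigma\frac1t\,\mu_v(\mathrm{d}t),\qquad \sigma\in\mathfrak{B}(\mathbb{R}_+),\ u\in V,$$ where $\mathrm{Chi}(u)$ denotes the set of all children of $u$. Then $S_\lambda$ is subnormal.
   Context: A directed tree is a connected directed graph without circuits in which each vertex has at most one parent $\mathrm{par}(v)$; rootless: every vertex has a parent; leafless: every vertex has a child. The weighted shift $S_\lambda$ in $\ell^2(V)$ is defined by $\mathcal{D}(S_\lambda)=\{f\in\ell^2(V):\Lambda f\in\ell^2(V)\}$, $S_\lambda f=\Lambda f$, where $(\Lambda f)(v)=\lambda_v f(\mathrm{par}(v))$ for $v\in V$. Convention $1/0=\infty$, $0\cdot\infty=0$. $\mathbb{R}_+=[0,\infty)$ with Borel $\sigma$-algebra $\mathfrak{B}(\mathbb{R}_+)$. A densely defined operator $S$ in $\mathcal{H}$ is subnormal if there are a Hilbert space $\mathcal{K}\supseteq\mathcal{H}$ and a normal $N$ in $\mathcal{K}$ with $\mathcal{D}(S)\subseteq\mathcal{D}(N)$ and $Sf=Nf$ on $\mathcal{D}(S)$. *)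

(* Defs.v *)
From HB Require Import structures.
From mathcomp Require Import all_boot all_order all_algebra.
From mathcomp Require Import all_classical all_reals all_analysis.
From mathcomp Require Import complex.
Set Implicit Arguments. Unset Strict Implicit. Unset Printing Implicit Defensive.
Import Order.TTheory GRing.Theory Num.Theory.
Local Open Scope classical_set_scope.
Local Open Scope ring_scope.

Section Defs.
Variable R : realType.
Local Notation C := (R[i]).

Definition csq (z : C) : R := complex.Re z ^+ 2 + complex.Im z ^+ 2.
Definition cconj (z : C) : C := Complex (complex.Re z) (- complex.Im z).

Section Tree.
Variable V : choiceType.
Variable par : V -> V.  (* total: every vertex has a parent (rootless) *)
(* connected (underlying undirected graph) and without circuits *)
Definition directed_tree : Prop :=
  (forall u v : V, exists m n : nat, iter m par u = iter n par v) /\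
  (forall (n : nat) (v : V), iter n.+1 par v <> v).
Definition leafless : Prop := forall u : V, exists v : V, par v = u.
Definition Chi (u : V) : set V := [set v | par v = u].
End Tree.

Section Shift.
Variable V : choiceType.
Definition l2sq (f : V -> C) : \bar R := (\esum_(v in [set: V]) (csq (f v))%:E)%E.
Definition in_l2 (f : V -> C) : Prop := (l2sq f < +oo)%E.
Variables (par : V -> V) (lam : V -> C).
Definition Lam (f : V -> C) : V -> C := fun v => lam v * f (par v).
Definition dom_S : set (V -> C) := [set f | in_l2 f /\ in_l2 (Lam f)].
Definition densely_defined_shift : Prop :=
  forall f, in_l2 f -> forall e : R, 0 < e ->
    exists g, dom_S g /\ (l2sq (fun v => (f v - g v)%R) < e%:E)%E.
End Shift.

Section Hilbert.
Variables (K : lmodType C) (ip : K -> K -> C).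
Definition hn (x : K) : R := complex.Re (ip x x).
Definition hconverges (u : nat -> K) (l : K) : Prop :=
  forall e : R, 0 < e -> exists N, forall n, (N <= n)%N -> hn (u n - l) < e.
Definition hcauchy (u : nat -> K) : Prop :=
  forall e : R, 0 < e -> exists N, forall m n, (N <= m)%N -> (N <= n)%N ->
    hn (u m - u n) < e.
Definition is_hilbert : Prop :=
  [/\ (forall (a : C) (x y z : K), ip (a *: x + y) z = a * ip x z + ip y z),
      (forall x y, ip y x = cconj (ip x y)),
      (forall x, 0 <= hn x),
      (forall x, ip x x = 0 -> x = 0) &
      (forall u, hcauchy u -> exists l, hconverges u l)].

(* operators in K are represented by their graphs *)
Definition op_linear (G : set (K * K)) : Prop :=
  G (0, 0) /\ forall (a : C) x y x' y', G (x, y) -> G (x', y') ->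
    G (a *: x + x', a *: y + y').
Definition op_single_valued (G : set (K * K)) : Prop :=
  forall x y y', G (x, y) -> G (x, y') -> y = y'.
Definition op_dom (G : set (K * K)) : set K := [set x | exists y, G (x, y)].
Definition op_densely_defined (G : set (K * K)) : Prop :=
  forall x (e : R), 0 < e -> exists y, op_dom G y /\ hn (x - y) < e.
Definition op_closed (G : set (K * K)) : Prop :=
  forall (u v : nat -> K) x y, (forall n, G (u n, v n)) ->
    hconverges u x -> hconverges v y -> G (x, y).
Definition op_adjoint (G : set (K * K)) : set (K * K) :=
  [set p | forall x y, G (x, y) -> ip y p.1 = ip x p.2].
Definition op_comp (A B : set (K * K)) : set (K * K) :=
  [set p | exists z, B (p.1, z) /\ A (z, p.2)].
Definition normal_op (G : set (K * K)) : Prop :=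
  [/\ op_linear G, op_single_valued G, op_densely_defined G, op_closed G &
      op_comp (op_adjoint G) G = op_comp G (op_adjoint G)].
End Hilbert.

Definition isometric_embedding (V : choiceType) (K : lmodType C) (ip : K -> K -> C)
    (J : (V -> C) -> K) : Prop :=
  (forall (a : C) f g, in_l2 f -> in_l2 g ->
     J (fun v => a * f v + g v) = a *: J f + J g) /\
  (forall f, in_l2 f -> ((hn ip (J f))%:E = l2sq f)%E).

Definition subnormal_shift (V : choiceType) (par : V -> V) (lam : V -> C) : Prop :=
  exists (K : lmodType C) (ip : K -> K -> C) (J : (V -> C) -> K) (G : set (K * K)),
    [/\ is_hilbert ip, isometric_embedding ip J, normal_op ip G &
        forall f, dom_S par lam f -> G (J f, J (Lam par lam f))].

Definition inv_t (t : R) : \bar R := if t == 0 then +oo%E else (t^-1)%:E.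
End Defs.

(* Main.v *)
Require Import Defs.
From HB Require Import structures.
From mathcomp Require Import all_boot all_order all_algebra.
From mathcomp Require Import all_classical all_reals all_analysis.
From mathcomp Require Import measurable_realfun.
From mathcomp Require Import complex generic_quotient ring lra.
Import Order.TTheory GRing.Theory Num.Theory.
Import numFieldNormedType.Exports HBNNSimple.
Local Open Scope classical_set_scope.
Local Open Scope ring_scope.

(** Let [M] be the sum of the measures [mu v] over the slices [{v} x R] of
    [V x R], and let [H = L^2(M)].  The consistency condition says exactly that
      [(U F)(v, t) = lam v * t^(-1/2) * F (par v, t)]
    is an isometry of [H]; it commutes with the selfadjoint operator [A] of
    multiplication by [t^(1/2)].  As every [mu v] has mass one, sending [f] to
    [(v, t) |-> f v] embeds [l^2(V)] isometrically in [H], and on [dom S] the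
    shift becomes [U A].  The isometry [U] dilates to the unitary operator
      [W = [[U, 1 - U U*], [0, U*]]]
    on [H (+) H], which commutes with [A (+) A], so that [W (A (+) A)] is a
    normal extension of the shift. *)

Set Implicit Arguments. Unset Strict Implicit. Unset Printing Implicit Defensive.

(** * Inner products and the normal extension *)

(** The factor t^(-1/2) turns the consistency condition into an isometry statement: the weights |lam
    v|^2 / t over the children of u reassemble mu u. The price is the factor t^(1/2), so [A] is
    unbounded in general and domains must be controlled. Two facts do this. The convention 1/0 = oo
    forces every mu v to have no mass at 0, so t^(1/2) t^(-1/2) = 1 almost everywhere. And U
    preserves the integral of |F|^2 for every measurable F, finite or not; as it carries t^(1/2) f
    to Lam f, finiteness of the norm of Lam f already puts f in the domain of [A]. A dilation is
    required because U is not onto in general: over siblings v, the functions (U F)(v, .) are all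
    multiples of one function, F(par v, .) t^(-1/2). *)

Section ComplexSquare.
Variable R : realType.
Implicit Types z w : R[i].

Lemma cconjE z : cconj z = (z^*)%C. Proof. by case: z. Qed.

Lemma csq_ge0 z : 0 <= csq z.
Proof. by rewrite addr_ge0 ?sqr_ge0. Qed.

Lemma csq_eq0 z : csq z = 0 -> z = 0.
Proof.
case: z => x y; rewrite /csq/= => /eqP.
by rewrite paddr_eq0 ?sqr_ge0// !sqrf_eq0 => /andP[/eqP-> /eqP->].
Qed.

Lemma csqM z w : csq (z * w) = csq z * csq w.
Proof. by case: z w => [x y] [u v]; rewrite /csq/=; ring. Qed.

Lemma csqN z : csq (- z) = csq z.
Proof. by case: z => x y; rewrite /csq/=; ring. Qed.

Lemma csqD_le z w : csq (z + w) <= 2 * csq z + 2 * csq w.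
Proof.
case: z w => [x y] [u v]; rewrite /csq/=.
by have := sqr_ge0 (x - u); have := sqr_ge0 (y - v); lra.
Qed.

Lemma csqR (x : R) : csq x%:C%C = x ^+ 2.
Proof. by rewrite /csq/= expr0n addr0. Qed.

Lemma conjc_realM (r : R) z : ((r%:C * z)^*)%C = (r%:C * z^*)%C.
Proof.
case: z => x y; apply/eqP; rewrite eq_complex/=.
by apply/andP; split; apply/eqP; ring.
Qed.

Lemma csq0 : csq (0 : R[i]) = 0.
Proof. by rewrite /csq/= expr0n addr0. Qed.

Lemma csq_gt0 z : z != 0 -> 0 < csq z.
Proof.
move=> z0; rewrite lt0r csq_ge0 andbT.
by apply: contra z0 => /eqP/csq_eq0 ->.
Qed.

End ComplexSquare.

Lemma invS_lt (R : realType) (e : R) : 0 < e ->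
  exists N, forall n, (N <= n)%N -> n.+1%:R^-1 < e.
Proof.
move=> e0; exists (Num.truncn e^-1) => n Nn.
rewrite invf_plt ?posrE ?ltr0n//; apply: lt_le_trans (truncnS_gt _) _.
by rewrite ler_nat ltnS.
Qed.

(** Definiteness and completeness are left out so that one calculus serves both square integrable
    functions, before null functions are divided out, and Hilbert spaces, which reach it through the
    coercion [hilbert_semi]. *)
Definition semi_inner_product (R : realType) (K : lmodType R[i])
    (ip : K -> K -> R[i]) : Prop :=
  [/\ (forall (a : R[i]) (x y z : K), ip (a *: x + y) z = a * ip x z + ip y z),
      (forall x y, ip y x = cconj (ip x y)) &
      (forall x, 0 <= hn ip x)].

Lemma hilbert_semi (R : realType) (K : lmodType R[i]) (ip : K -> K -> R[i]) :
  is_hilbert ip -> semi_inner_product ip.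
Proof. by case. Qed.
Coercion hilbert_semi : is_hilbert >-> semi_inner_product.

Section SemiInnerProduct.
Variables (R : realType) (K : lmodType R[i]) (ip : K -> K -> R[i]).
Hypothesis hK : semi_inner_product ip.
Implicit Types (x y z : K) (a : R[i]).

Local Notation hn := (hn ip).

Lemma ipP a x y z : ip (a *: x + y) z = a * ip x z + ip y z.
Proof. by case: hK => + _ _; exact. Qed.

Lemma ipC x y : ip y x = (ip x y)^*%C.
Proof. by rewrite -cconjE; case: hK => _ + _; exact. Qed.

Lemma hn_ge0 x : 0 <= hn x.
Proof. by case: hK => _ _; exact. Qed.

Lemma ipDl x y z : ip (x + y) z = ip x z + ip y z.
Proof. by rewrite -[x]scale1r ipP mul1r scale1r. Qed.

Lemma ip0l z : ip 0 z = 0.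
Proof. by apply: (addrI (ip 0 z)); rewrite -ipDl !addr0. Qed.

Lemma ipZl a x z : ip (a *: x) z = a * ip x z.
Proof. by rewrite -[a *: x]addr0 ipP ip0l addr0. Qed.

Lemma ipNl x z : ip (- x) z = - ip x z.
Proof. by rewrite -scaleN1r ipZl mulN1r. Qed.

Lemma ipBl x y z : ip (x - y) z = ip x z - ip y z.
Proof. by rewrite ipDl ipNl. Qed.

Lemma ipDr x y z : ip z (x + y) = ip z x + ip z y.
Proof. by rewrite ipC ipDl rmorphD/= -!ipC. Qed.

Lemma ip0r z : ip z 0 = 0.
Proof. by rewrite ipC ip0l rmorph0. Qed.

Lemma ipZr a x z : ip z (a *: x) = a^*%C * ip z x.
Proof. by rewrite ipC ipZl rmorphM/= -ipC. Qed.

Lemma ipNr x z : ip z (- x) = - ip z x.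
Proof. by rewrite ipC ipNl rmorphN/= -ipC. Qed.

Lemma ipBr x y z : ip z (x - y) = ip z x - ip z y.
Proof. by rewrite ipDr ipNr. Qed.

Lemma ipxx x : ip x x = (hn x)%:C%C.
Proof.
have := ipC x x; rewrite /Defs.hn; case: (ip x x) => u v [] /= /eqP.
by rewrite -subr_eq0 opprK -mulr2n mulrn_eq0/= => /eqP ->.
Qed.

Lemma hn0 : hn 0 = 0. Proof. by rewrite /Defs.hn ip0l. Qed.

Lemma hnZ a x : hn (a *: x) = csq a * hn x.
Proof.
rewrite /Defs.hn ipZl ipZr ipxx; case: a => u v; rewrite /csq/=.
by ring.
Qed.

Lemma hnN x : hn (- x) = hn x.
Proof. by rewrite /Defs.hn ipNl ipNr opprK. Qed.

Lemma hnBC x y : hn (x - y) = hn (y - x).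
Proof. by rewrite -hnN opprB. Qed.

Lemma hnD x y : hn (x + y) = hn x + hn y + 2 * complex.Re (ip x y).
Proof.
rewrite /Defs.hn ipDl !ipDr (ipC x y) !raddfD/=.
by case: (ip x y) => u v /=; ring.
Qed.

Lemma hnB x y : hn (x - y) = hn x + hn y - 2 * complex.Re (ip x y).
Proof. by rewrite hnD hnN ipNr raddfN/= mulrN. Qed.

Lemma parallelogram x y : hn (x + y) + hn (x - y) = 2 * hn x + 2 * hn y.
Proof. by rewrite hnD hnB; ring. Qed.

Lemma hnD_le x y : hn (x + y) <= 2 * hn x + 2 * hn y.
Proof. by rewrite -parallelogram lerDl hn_ge0. Qed.

(** For real t > 0, [hn] of x - t <x,y> y equals hn x - 2 t |<x,y>|^2 when y is null; it stays
    nonnegative for arbitrarily large t only if <x,y> = 0. *)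
Lemma ip_null x y : hn y = 0 -> ip x y = 0.
Proof.
move=> y0; apply/csq_eq0/eqP; rewrite eq_le csq_ge0 andbT.
apply/ler_addgt0Pr => e e0; rewrite add0r.
(* Chosen so that 2 t e exceeds [hn x], which contradicts nonnegativity as soon as |<x,y>|^2 > e. *)
pose t := (hn x + 1) / (2 * e).
have te : t * (2 * e) = hn x + 1 by rewrite divfK// mulf_neq0// gt_eqF.
have t0 : 0 < t by rewrite divr_gt0 ?ltr_wpDl ?hn_ge0 ?mulr_gt0.
have := hn_ge0 (x - (t%:C%C * ip x y) *: y).
rewrite hnB hnZ y0 mulr0 addr0 ipZr.
have -> : complex.Re ((t%:C * ip x y)^* * ip x y)%C = t * csq (ip x y).
  by case: (ip x y) => u v; rewrite /csq/=; ring.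
rewrite subr_ge0 leNgt => /negP h; rewrite leNgt; apply/negP => h'; apply: h.
apply: (@lt_trans _ _ (2 * (t * e))); last by rewrite ltr_pM2l// ltr_pM2l.
by rewrite mulrCA te ltrDl.
Qed.

Lemma cauchy_schwarz x y : csq (ip x y) <= hn x * hn y.
Proof.
have [y0|y0] := eqVneq (hn y) 0; first by rewrite ip_null// csq0 y0 mulr0.
have yp : 0 < hn y by rewrite lt0r y0 hn_ge0.
(* This expands to hn y * (hn x * hn y - |<x,y>|^2). *)
have := hn_ge0 ((hn y)%:C%C *: x - ip x y *: y).
rewrite hnB !hnZ ipZl ipZr csqR.
have -> : complex.Re ((hn y)%:C * ((ip x y)^* * ip x y))%C = hn y * csq (ip x y).
  by case: (ip x y) => u v; rewrite /csq/=; ring.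
by nra.
Qed.

End SemiInnerProduct.

Section InnerProduct.
Variables (R : realType) (K : lmodType R[i]) (ip : K -> K -> R[i]).
Hypothesis hK : is_hilbert ip.
Implicit Types (x y z : K) (a : R[i]).

Local Notation hn := (hn ip).

Lemma hn_eq0 x : hn x = 0 -> x = 0.
Proof. by move=> h; case: hK => _ _ _ + _; apply; rewrite (ipxx hK) h. Qed.

Lemma ip_inj x y : (forall z, ip z x = ip z y) -> x = y.
Proof.
move=> h; apply/eqP; rewrite -subr_eq0; apply/eqP/hn_eq0.
by rewrite /Defs.hn (ipBr hK) h subrr.
Qed.

Lemma hconverges_ip u l z : hconverges ip u l ->
  forall e : R, 0 < e -> exists N, forall n, (N <= n)%N ->
    csq (ip z (u n) - ip z l) < e.
Proof.
move=> ul e e0; have z1 : 0 < hn z + 1 by rewrite ltr_pwDr// (hn_ge0 hK).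
have [N hN] := ul (e / (hn z + 1)) (divr_gt0 e0 z1).
exists N => n /hN h; rewrite -(ipBr hK); apply: le_lt_trans (cauchy_schwarz hK _ _) _.
apply: (@le_lt_trans _ _ ((hn z + 1) * hn (u n - l))).
  by rewrite ler_wpM2r ?(hn_ge0 hK)// lerDl.
by rewrite mulrC -ltr_pdivlMr.
Qed.

(** Each equation defining the adjoint is continuous in the pair (x, y), by Cauchy-Schwarz, so it
    passes to limits. *)
Lemma op_adjoint_closed (G : set (K * K)) : op_closed ip (op_adjoint ip G).
Proof.
move=> u v x y Guv ux vy a b Gab /=.
apply/eqP; rewrite -subr_eq0; apply/eqP/csq_eq0/eqP.
rewrite eq_le csq_ge0 andbT; apply/ler_addgt0Pr => e e0; rewrite add0r.
have e4 : 0 < e / 4 by rewrite divr_gt0.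
have [M hM] := hconverges_ip b ux e4.
have [N hN] := hconverges_ip a vy e4.
have /hM h1 := leq_maxl M N; have /hN h2 := leq_maxr M N.
have := Guv (maxn M N) _ _ Gab; set n := maxn M N in h1 h2 * => /= E.
rewrite (_ : _ - _ = (ip a (v n) - ip a y) + - (ip b (u n) - ip b x)); last first.
  by rewrite E; ring.
apply: le_trans (csqD_le _ _) _; rewrite csqN.
rewrite [e in X in _ <= X](_ : e = 2 * (e / 4) + 2 * (e / 4)); last by field.
by rewrite lerD// ler_pM2l// ltW.
Qed.

End InnerProduct.

(** * Isometries of a Hilbert space: polarization and existence of the adjoint *)

Section Isometry.
Variables (R : realType) (K : lmodType R[i]) (ip : K -> K -> R[i]).
Hypothesis hK : is_hilbert ip.
Variable U : K -> K.
Hypothesis Ulin : forall (a : R[i]) x y, U (a *: x + y) = a *: U x + U y.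
Hypothesis Uiso : forall x, hn ip (U x) = hn ip x.

Local Notation hn := (hn ip).
Local Notation Re := complex.Re.
Local Notation Im := complex.Im.

Let UD x y : U (x + y) = U x + U y.
Proof. by rewrite -[x in LHS]scale1r Ulin scale1r. Qed.

Let U0 : U 0 = 0.
Proof. by apply: (addrI (U 0)); rewrite -UD !addr0. Qed.

Let UZ a x : U (a *: x) = a *: U x.
Proof. by rewrite -[a *: x]addr0 Ulin U0 addr0. Qed.

Let UN x : U (- x) = - U x.
Proof. by rewrite -scaleN1r UZ scaleN1r. Qed.

Let UB x y : U (x - y) = U x - U y.
Proof. by rewrite UD UN. Qed.

(** Polarization: [hn] of a sum determines the real part of the inner product, and the imaginary
    part is the real part after multiplying the first argument by -i. *)
Lemma isometry_ip x y : ip (U x) (U y) = ip x y.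
Proof.
have ReU u v : Re (ip (U u) (U v)) = Re (ip u v).
  apply: (@mulfI _ 2) => //; apply: (addrI (hn u + hn v)).
  by rewrite -(hnD hK) -(Uiso u) -(Uiso v) -(hnD hK) -UD Uiso.
have ImRe z : Im z = Re (- 'i%C * z) :> R.
  by case: z => u v /=; ring.
apply/eqP; rewrite eq_complex ReU eqxx/= !ImRe -!(ipZl hK) -UZ.
by rewrite ReU.
Qed.

(* [U y] is the point of the range of [U] nearest to [x]. *)
Lemma isometry_adjoint_exists x : exists y, forall z, ip (U z) x = ip z y.
Proof.
pose D := [set hn (x - U y) | y in [set: K]].
have D0 : D !=set0 by exists (hn (x - U 0)); exists 0.
have Dlb : has_lbound D by exists 0 => _ [y _ <-]; exact: (hn_ge0 hK).
have Dinf : has_inf D by split.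
pose d := inf D.
have dle y : d <= hn (x - U y) by apply: ge_inf => //; exists y.
have seqP (n : nat) : exists y, hn (x - U y) < d + n.+1%:R^-1.
  have [_ [y _ <-] h] := @inf_adherent _ D (n.+1%:R^-1) ltac:(by []) Dinf.
  by exists y.
have [y hy] := choice seqP.
(* Parallelogram law: the midpoint of [y m] and [y n] is again a competitor, so its squared distance
   is at least d, which cancels the d in the bounds on the two sides. *)
have ymn m n : hn (y m - y n) <= 2 * m.+1%:R^-1 + 2 * n.+1%:R^-1.
  rewrite -Uiso UB.
  have := parallelogram hK (x - U (y n)) (x - U (y m)).
  rewrite (_ : _ - _ - (_ - _) = U (y m) - U (y n)); last first.
    by rewrite opprB addrC addrA subrK.
  have -> : x - U (y n) + (x - U (y m)) =
      2%:R *: (x - U (2%:R^-1 *: (y n + y m))).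
    rewrite scalerBr -UZ scalerA divff ?pnatr_eq0// scale1r UD scaler_nat mulr2n.
    by rewrite opprD addrACA.
  rewrite (hnZ hK) (_ : csq _ = 4); last first.
    by rewrite /csq/= ; ring.
  have := dle (2%:R^-1 *: (y n + y m)); have := hy m; have := hy n.
  move: (hn _) (hn _) (hn _) (hn _) => p q r s.
  by move: (m.+1%:R^-1) (n.+1%:R^-1) => i j; lra.
have yC : hcauchy ip y.
  move=> e e0; have [N hN] := invS_lt (divr_gt0 e0 (ltr0n R 4)).
  exists N => m n /hN + /hN; rewrite !ltr_pdivlMr// => hm hn.
  apply: le_lt_trans (ymn _ _) _.
  by move: hm hn; move: (m.+1%:R^-1) (n.+1%:R^-1) => i j; lra.
have [l yl] : exists l, hconverges ip y l by case: hK => _ _ _ _; exact.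
exists l.
(* Replacing z by -i z recovers the imaginary part. *)
suff Re0 z : Re (ip (U z) (x - U l)) = 0.
  move=> z; apply/eqP; rewrite -subr_eq0 -(isometry_ip z) -(ipBr hK).
  rewrite eq_complex Re0 eqxx/=.
  have := Re0 (- 'i%C *: z); rewrite UZ (ipZl hK).
  by case: (ip _ _) => u v /= <-; apply/eqP; ring.
have half w : 0 <= Re (ip (U w) (x - U l)).
  rewrite -(pmulr_rge0 _ (ltr0n R 2)); apply/ler_addgt0Pr => e e0.
  (* First variation in the direction -w with step r. Both n.+1^-1 and hn (y n - l) are pushed below
     r^2, so after division by r the total error is r (2 hn w + 2) = e. *)
  pose r := e / (2 * hn w + 2).
  have w2 : 0 < 2 * hn w + 2 by have := hn_ge0 hK w; lra.
  have r0 : 0 < r by rewrite divr_gt0.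
  have er : e = r * (2 * hn w + 2) by rewrite divfK ?gt_eqF.
  have rr0 : 0 < r ^+ 2 by rewrite exprn_gt0.
  have [N hN] := yl _ rr0.
  have [M hM] := invS_lt rr0; pose n := maxn N M.
  have n2 : n.+1%:R^-1 < r ^+ 2 := hM n (leq_maxr _ _).
  have h1 := hN n (leq_maxl _ _); have h2 := hy n.
  have := dle (y n - r%:C%C *: w).
  rewrite UB UZ opprB addrA addrAC.
  rewrite (hnD hK) (hnZ hK) csqR Uiso (ipZr hK) conjc_real.
  rewrite (_ : Re (_ * ip _ _) = r * Re (ip (x - U (y n)) (U w))); last first.
    by case: (ip _ _) => u v /=; ring.
  have -> : Re (ip (x - U (y n)) (U w)) =
      Re (ip (U w) (x - U l)) - Re (ip w (y n - l)).
    rewrite -(isometry_ip w) UB -raddfB/= -(ipBr hK) opprB addrA subrK.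
    by rewrite (ipC hK); case: (ip _ _).
  have h3 : - (2 * r * Re (ip w (y n - l))) <= r ^+ 2 * hn w + hn (y n - l).
    have := hn_ge0 hK (r%:C%C *: w + (y n - l)).
    rewrite (hnD hK (r%:C%C *: w)) (hnZ hK) csqR (ipZl hK)
      (_ : Re (_ * ip _ _) = r * Re (ip w (y n - l))).
      by lra.
    by case: (ip _ _) => u v /=; ring.
  rewrite er -(pmulr_rge0 _ r0); move: h1 h2 h3 n2.
  move: (n.+1%:R^-1) (Re _) (Re _) (hn _) (hn _) (hn _) => i q p s1 s2 s3.
  move=> h1 h2 h3 n2 h4.
  have -> : r * (2 * q + r * (2 * s1 + 2)) = 2 * (r * q) + r ^+ 2 * (2 * s1 + 2).
    by ring.
  rewrite mulrBr in h4; lra.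
apply/eqP; rewrite eq_le half andbT.
by have := half (- z); rewrite UN (ipNl hK) raddfN/= oppr_ge0.
Qed.

End Isometry.

(** * Products of a unitary with a commuting selfadjoint operator *)

Section NormalProduct.
Variables (R : realType) (K : lmodType R[i]) (ip : K -> K -> R[i]).
Hypothesis hK : is_hilbert ip.
Variable A : set (K * K).

(** The set {p | A (p.1, W' p.2)} is the graph of W A. Its adjoint is A W', which equals W' A
    because W and W' preserve the graph of A. *)
Lemma adjoint_unitary_product (W W' : K -> K) :
  cancel W W' -> cancel W' W -> (forall x y, ip (W x) (W y) = ip x y) ->
  op_adjoint ip A = A ->
  (forall x y, A (x, y) -> A (W x, W y)) ->
  (forall x y, A (x, y) -> A (W' x, W' y)) ->
  op_adjoint ip [set p | A (p.1, W' p.2)] = [set p | A (p.1, W p.2)].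
Proof.
move=> WK W'K Wip Asa AW AW'; apply/seteqP; split=> [[y z]|[y z]] /= h.
  suff /AW : A (W' y, z) by rewrite W'K.
  rewrite -Asa => a b Aab /=.
  have := h a (W b); rewrite /= WK => /(_ Aab) <-.
  by rewrite -[in RHS](W'K y) Wip.
move=> x w /= Axw; have /AW' := h; rewrite WK.
rewrite -{1}Asa => /(_ _ _ Axw)/= <-.
by rewrite -[in RHS]Wip !W'K.
Qed.

(** For N = W A the adjoint is W' A, and commutation brings both products of N with its adjoint to
    the square of A. Closedness comes from N being itself an adjoint, that of W' A. *)
Lemma unitary_product_normal (W W' : K -> K) :
  cancel W W' -> cancel W' W ->
  (forall (a : R[i]) x y, W (a *: x + y) = a *: W x + W y) ->
  (forall x y, ip (W x) (W y) = ip x y) ->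
  op_linear A -> op_single_valued A -> op_densely_defined ip A ->
  op_adjoint ip A = A ->
  (forall x y, A (x, y) -> A (W x, W y)) ->
  (forall x y, A (x, y) -> A (W' x, W' y)) ->
  normal_op ip [set p | A (p.1, W' p.2)].
Proof.
move=> WK W'K Wlin Wip Alin Asv Add Asa AW AW'.
have W'ip x y : ip (W' x) (W' y) = ip x y by rewrite -Wip !W'K.
have W'lin a x y : W' (a *: x + y) = a *: W' x + W' y.
  by rewrite -[RHS]WK Wlin !W'K.
have W'0 : W' 0 = 0.
  have := W'lin 1 0 0; rewrite !scale1r !addr0.
  by move/esym/(canRL (addKr _)) => ->; rewrite addNr.
split.
- split=> /=; first by rewrite W'0; case: Alin.
  by move=> a x y x' y' /= h h'; rewrite W'lin; case: Alin => _; exact.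
- by move=> x y y' /= h h'; apply: (can_inj W'K); exact: Asv h h'.
- move=> x e e0; have [y [[z Ayz] h]] := Add x e e0.
  by exists y; split=> //; exists (W z); rewrite /= WK.
- rewrite -(adjoint_unitary_product W'K WK W'ip Asa AW' AW).
  exact: op_adjoint_closed.
- rewrite (adjoint_unitary_product WK W'K Wip Asa AW AW'); apply/seteqP.
  split=> [[x w]|[x w]] [z [/= h1 h2]].
    (* The intermediate vector z = W A x is exchanged for W' A x, which is W' applied twice to z. *)
    exists (W' (W' z)); rewrite /= W'K; split=> //.
    by have := AW' _ _ h2; rewrite WK => /AW'.
  exists (W (W z)); rewrite /= WK; split=> //.
  by have := AW _ _ h2; rewrite W'K => /AW.
Qed.

End NormalProduct.

Section HilbertSquare.
Variables (R : realType) (K : lmodType R[i]) (ip : K -> K -> R[i]).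
Hypothesis hK : is_hilbert ip.

Definition ip2 (p q : K * K) : R[i] := ip p.1 q.1 + ip p.2 q.2.

Lemma hn_ip2 p : hn ip2 p = hn ip p.1 + hn ip p.2.
Proof. by rewrite /hn /ip2 raddfD. Qed.

Lemma ip2_hilbert : is_hilbert ip2.
Proof.
split.
- by move=> a x y z; rewrite /ip2 /= !(ipP hK) mulrDr addrACA.
- by move=> x y; rewrite /ip2 cconjE rmorphD/= -!(ipC hK).
- by move=> x; rewrite hn_ip2 addr_ge0 ?(hn_ge0 hK).
- move=> [x y] h; have : hn ip2 (x, y) = 0 by rewrite /hn h.
  rewrite hn_ip2/= => /eqP; rewrite paddr_eq0 ?(hn_ge0 hK)// => /andP[].
  by move=> /eqP/(hn_eq0 hK) -> /eqP/(hn_eq0 hK) ->.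
move=> u uC; have lim1 (g : K * K -> K) :
    (forall p q, g (p - q) = g p - g q) ->
    (forall p, hn ip (g p) <= hn ip2 p) ->
    exists l, hconverges ip (g \o u) l.
  move=> gB gle; case: hK => _ _ _ _; apply => e e0.
  have [N hN] := uC e e0; exists N => m n Nm Nn /=.
  by rewrite -gB; apply: le_lt_trans (gle _) _; exact: hN.
have [||x ux] := lim1 fst => //.
  by move=> p; rewrite hn_ip2 lerDl (hn_ge0 hK).
have [||y uy] := lim1 snd => //.
  by move=> p; rewrite hn_ip2 lerDr (hn_ge0 hK).
exists (x, y) => e e0; have e2 : 0 < e / 2 by rewrite divr_gt0.
have [M hM] := ux _ e2; have [N hN] := uy _ e2.
exists (maxn M N) => n; rewrite geq_max => /andP[/hM h1 /hN h2].
by rewrite hn_ip2 [e]splitr ltrD.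
Qed.

End HilbertSquare.

Section HalmosDilation.
Variables (R : realType) (K : lmodType R[i]) (ip : K -> K -> R[i]).
Hypothesis hK : is_hilbert ip.
Variables (U : K -> K) (A : set (K * K)).
Hypothesis Ulin : forall (a : R[i]) x y, U (a *: x + y) = a *: U x + U y.
Hypothesis Uiso : forall x, hn ip (U x) = hn ip x.
Hypotheses (Alin : op_linear A) (Asv : op_single_valued A).
Hypotheses (Add : op_densely_defined ip A) (Asa : op_adjoint ip A = A).
Hypothesis AU : forall x y, A (x, y) -> A (U x, U y).

(* For an isometry [U] with [P := 1 - U U*], the block operator
   [[U, P], [0, U*]] is unitary, and it commutes with [A (+) A]. *)
Lemma isometry_mul_selfadjoint_subnormal :
  exists2 G : set ((K * K) * (K * K)), normal_op (ip2 ip) G &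
    forall x y, A (x, y) -> G ((x, 0), (U y, 0)).
Proof.
have [V UV] := choice (isometry_adjoint_exists hK Ulin Uiso).
have VU x z : ip (V x) z = ip x (U z).
  by rewrite (ipC hK) -UV -(ipC hK).
have Uip := isometry_ip hK Ulin Uiso.
have VK : cancel U V by move=> x; apply: (ip_inj hK) => z; rewrite -UV Uip.
have Vlin a x y : V (a *: x + y) = a *: V x + V y.
  by apply: (ip_inj hK) => z; rewrite -UV !(ipDr hK) !(ipZr hK) !UV.
have UD x y : U (x + y) = U x + U y by rewrite -[x in LHS]scale1r Ulin scale1r.
have VD x y : V (x + y) = V x + V y by rewrite -[x in LHS]scale1r Vlin scale1r.
have U0 : U 0 = 0 by apply: (addrI (U 0)); rewrite -UD !addr0.
have V0 : V 0 = 0 by apply: (addrI (V 0)); rewrite -VD !addr0.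
have VN x : V (- x) = - V x.
  by apply: (addrI (V x)); rewrite -VD !subrr.
pose W (p : K * K) := (U p.1 + (p.2 - U (V p.2)), V p.2).
(* The adjoint of [W], with blocks [[V, 0], [P, U]] where V is the adjoint of U and P = 1 - U V.
   That both products are the identity rests on V U = 1 and V P = 0. *)
pose W' (p : K * K) := (V p.1, (p.1 - U (V p.1)) + U p.2).
have VP u v : V (U u + (v - U (V v))) = u.
  by rewrite VD VD VN !VK subrr addr0.
have WK : cancel W W'.
  move=> [x y]; rewrite /W /W' /= VP; congr pair.
  by rewrite [U x + _]addrC addrK subrK.
have W'K : cancel W' W.
  move=> [x y]; rewrite /W /W' /= [_ - _ + _]addrC VP; congr pair.
  by rewrite addrAC subrr add0r addrC subrK.
have Wlin a x y : W (a *: x + y) = a *: W x + W y.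
  rewrite /W /= !Vlin !Ulin; congr pair => /=.
  rewrite opprD (addrACA (a *: x.2)) -scalerBr.
  by rewrite (addrACA (a *: U x.1)) -scalerDr.
have Wip p q : ip2 ip (W p) (W q) = ip2 ip p q.
  have ipU u v : ip (U u) (v - U (V v)) = 0.
    by rewrite UV VD VN VK subrr (ip0r hK).
  have Uip0 u v : ip (v - U (V v)) (U u) = 0 by rewrite (ipC hK) ipU rmorph0.
  rewrite /ip2 /= (ipDl hK) !(ipDr hK (U q.1)) ipU Uip0 addr0 add0r Uip.
  rewrite -addrA; congr (_ + _).
  rewrite [X in X + _](ipBr hK) Uip0 subr0 (ipBl hK).
  by rewrite UV subrK.
pose A2 : set ((K * K) * (K * K)) :=
  [set p | A (p.1.1, p.2.1) /\ A (p.1.2, p.2.2)].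
(* Commutation with U passes to its adjoint V by selfadjointness of [A]: the pair (V x, V y) is
   tested against (a, b) by moving V over as U. *)
have AV x y : A (x, y) -> A (V x, V y).
  move=> Axy; rewrite -Asa => a b Aab /=; rewrite -!UV.
  by have /AU := Aab; rewrite -{1}Asa in Axy; move=> /Axy.
have AD x y x' y' : A (x, y) -> A (x', y') -> A (x + x', y + y').
  by case: Alin => _ h h1 h2; have := h 1 _ _ _ _ h1 h2; rewrite !scale1r.
have AB x y x' y' : A (x, y) -> A (x', y') -> A (x - x', y - y').
  case: Alin => _ h h1 h2; have := h (-1) _ _ _ _ h2 h1.
  by rewrite !scaleN1r ![- _ + _]addrC.
exists [set p | A2 (p.1, W' p.2)]; last first.
  move=> x y Axy; rewrite /A2 /W' /= VK U0 addr0 subrr; split=> //.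
  by case: Alin.
apply: (unitary_product_normal (ip2_hilbert hK) WK W'K Wlin Wip).
- split; first by split=> /=; case: Alin.
  move=> a x y x' y' [h1 h2] [h3 h4].
  by split=> /=; case: Alin => _; exact.
- move=> [x y] [z w] [z' w'] [/= h1 h2] [/= h3 h4].
  by rewrite (Asv h1 h3) (Asv h2 h4).
- move=> [x1 x2] e e0; have e2 : 0 < e / 2 by rewrite divr_gt0.
  have [y1 [[z1 h1] l1]] := Add x1 e2; have [y2 [[z2 h2] l2]] := Add x2 e2.
  exists (y1, y2); split; first by exists (z1, z2).
  by rewrite hn_ip2 [e]splitr ltrD.
- apply/seteqP; split=> [[[y1 y2] [z1 z2]] h|[[y1 y2] [z1 z2]] [/= h1 h2]].
    have A00 : A (0, 0) by case: Alin.
    split=> /=; rewrite -Asa => a b Aab /=.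
      have := h (a, 0) (b, 0) (conj Aab A00).
      by rewrite /ip2/= !(ip0l hK) !addr0.
    have := h (0, a) (0, b) (conj A00 Aab).
    by rewrite /ip2/= !(ip0l hK) !add0r.
  move=> [a1 a2] [b1 b2] [/= g1 g2].
  by rewrite /ip2/=; rewrite -Asa in h1 h2; rewrite (h1 _ _ g1) (h2 _ _ g2).
- move=> x y [h1 h2]; split=> /=; last exact: AV.
  by apply: AD; [exact: AU|apply: AB => //; exact/AU/AV].
- move=> x y [h1 h2]; split=> /=; first exact: AV.
  by apply: AD; [apply: AB => //; exact/AU/AV|exact: AU].
Qed.

End HalmosDilation.

(** * The Hilbert space of a complete semi-inner product *)

Section HilbertQuotient.
Local Open Scope quotient_scope.
Variables (R : realType) (E : lmodType R[i]) (b : E -> E -> R[i]).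
Hypothesis hb : semi_inner_product b.

Definition null_rel (x y : E) : bool := hn b (x - y) == 0.

Let null_refl : reflexive null_rel.
Proof. by move=> x; rewrite /null_rel subrr (hn0 hb). Qed.
Let null_sym : symmetric null_rel.
Proof. by move=> x y; rewrite /null_rel (hnBC hb). Qed.
Let null_trans : transitive null_rel.
Proof.
move=> y x z /eqP xy /eqP yz; rewrite /null_rel eq_le (hn_ge0 hb) andbT.
by have := hnD_le hb (x - y) (y - z); rewrite addrA subrK xy yz mulr0 addr0.
Qed.

Definition null_equiv := EquivRel null_rel null_refl null_sym null_trans.
Definition hquot := {eq_quot null_equiv}.
HB.instance Definition _ := EqQuotient.on hquot.
HB.instance Definition _ := Choice.on hquot.

Definition hpi (x : E) : hquot := \pi_hquot x.

Lemma hpiP x y : hpi x = hpi y <-> hn b (x - y) = 0.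
Proof. by split=> [/eqmodP/eqP|/eqP h]; last exact/eqmodP. Qed.

Lemma hpiK x : hn b (repr (hpi x) - x) = 0.
Proof. by apply/hpiP; rewrite /hpi reprK. Qed.

Lemma hquotP (p : hquot) : exists x, p = hpi x.
Proof. by exists (repr p); rewrite /hpi reprK. Qed.

Definition hq_add (p q : hquot) : hquot := hpi (repr p + repr q).
Definition hq_opp (p : hquot) : hquot := hpi (- repr p).
Definition hq_scale (a : R[i]) (p : hquot) : hquot := hpi (a *: repr p).

Let null0 u v : hn b u = 0 -> hn b v = 0 -> hn b (u + v) = 0.
Proof.
move=> u0 v0; apply/eqP; rewrite eq_le (hn_ge0 hb) andbT.
by apply: le_trans (hnD_le hb _ _) _; rewrite u0 v0 mulr0 addr0.
Qed.

Let addE x y : hq_add (hpi x) (hpi y) = hpi (x + y).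
Proof. by apply/hpiP; rewrite opprD addrACA null0 ?hpiK. Qed.
Let oppE x : hq_opp (hpi x) = hpi (- x).
Proof. by apply/hpiP; rewrite -opprD (hnN hb) hpiK. Qed.
Let scaleE a x : hq_scale a (hpi x) = hpi (a *: x).
Proof. by apply/hpiP; rewrite -scalerBr (hnZ hb) hpiK mulr0. Qed.

Let addA : associative hq_add.
Proof.
move=> p q r; have [x ->] := hquotP p; have [y ->] := hquotP q.
by have [z ->] := hquotP r; rewrite !addE addrA.
Qed.
Let addC : commutative hq_add.
Proof.
by move=> p q; have [x ->] := hquotP p; have [y ->] := hquotP q; rewrite !addE addrC.
Qed.
Let add0 : left_id (hpi 0) hq_add.
Proof. by move=> p; have [x ->] := hquotP p; rewrite addE add0r. Qed.
Let addN : left_inverse (hpi 0) hq_opp hq_add.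
Proof. by move=> p; have [x ->] := hquotP p; rewrite oppE addE addNr. Qed.

HB.instance Definition _ := GRing.isZmodule.Build hquot addA addC add0 addN.

Let hpiD x y : hpi (x + y) = hpi x + hpi y.
Proof. by rewrite -addE. Qed.

Let scaleA a c p : hq_scale a (hq_scale c p) = hq_scale (a * c) p.
Proof. by have [x ->] := hquotP p; rewrite !scaleE scalerA. Qed.
Let scale1 : left_id 1 hq_scale.
Proof. by move=> p; have [x ->] := hquotP p; rewrite scaleE scale1r. Qed.
Let scaleDr : right_distributive hq_scale +%R.
Proof.
move=> a p q; have [x ->] := hquotP p; have [y ->] := hquotP q.
by rewrite -hpiD !scaleE scalerDr hpiD.
Qed.
Let scaleDl p : {morph hq_scale^~ p : a c / a + c}.
Proof. by move=> a c; have [x ->] := hquotP p; rewrite !scaleE scalerDl hpiD. Qed.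

HB.instance Definition _ :=
  GRing.Zmodule_isLmodule.Build R[i] hquot scaleA scale1 scaleDr scaleDl.

Lemma hpi_linear a x y : hpi (a *: x + y) = a *: hpi x + hpi y.
Proof. by rewrite hpiD -scaleE. Qed.

Lemma hpiB x y : hpi (x - y) = hpi x - hpi y.
Proof. by rewrite -scaleN1r addrC hpi_linear scaleN1r addrC. Qed.

Definition hq_ip (p q : hquot) : R[i] := b (repr p) (repr q).

(** Changing a representative alters the inner product by one with a null vector, which vanishes by
    [ip_null]. *)
Lemma hq_ipE x y : hq_ip (hpi x) (hpi y) = b x y.
Proof.
have nl u v w : hn b (u - v) = 0 -> b w u = b w v.
  by move=> uv; apply/eqP; rewrite -subr_eq0 -(ipBr hb) (ip_null hb).
rewrite /hq_ip (nl _ _ _ (hpiK y)) (ipC hb) (nl _ _ _ (hpiK x)).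
by rewrite -(ipC hb).
Qed.

Lemma hn_hpi x : hn hq_ip (hpi x) = hn b x.
Proof. by rewrite /hn hq_ipE. Qed.

(** Representatives of a Cauchy sequence of classes are Cauchy, since [hpi] preserves [hn]; a limit
    upstairs projects to a limit of classes. *)
Lemma hquot_hilbert :
  (forall u, hcauchy b u -> exists l, hconverges b u l) -> is_hilbert hq_ip.
Proof.
move=> bC; split.
- move=> a p q r; have [x ->] := hquotP p; have [y ->] := hquotP q.
  by have [z ->] := hquotP r; rewrite -hpi_linear !hq_ipE (ipP hb).
- move=> p q; have [x ->] := hquotP p; have [y ->] := hquotP q.
  by rewrite !hq_ipE cconjE -(ipC hb).
- by move=> p; have [x ->] := hquotP p; rewrite hn_hpi (hn_ge0 hb).
- move=> p; have [x ->] := hquotP p; rewrite hq_ipE => h.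
  by apply/hpiP; rewrite subr0 /hn h.
move=> u uC; pose v n := repr (u n).
have uv n : u n = hpi (v n) by rewrite /hpi reprK.
have [|l vl] := bC v.
  move=> e /uC[N hN]; exists N => m n Nm Nn.
  by have := hN m n Nm Nn; rewrite !uv -hpiB hn_hpi.
exists (hpi l) => e /vl[N hN]; exists N => n /hN.
by rewrite uv -hpiB hn_hpi.
Qed.

End HilbertQuotient.

(** * Square integrable complex functions *)

(** The increments are dominated by a geometric series of ratio 1/2, so the telescoping series
    converges absolutely. *)
Lemma cvg_fast_increments (R : realType) (x : nat -> R) (c : R) :
  (forall k, 4 ^+ k.+1 * (x k.+1 - x k) ^+ 2 <= c) -> cvgn x.
Proof.
move=> h; have c0 : 0 <= c.
  by apply: le_trans (h 0%N); rewrite mulr_ge0 ?sqr_ge0 ?exprn_ge0.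
suff : cvgn (series (telescope x)).
  rewrite telescopeK => hx.
  have -> : x = [sequence x n - x 0%N]_n + cst (x 0%N).
    by apply/funext => n /=; rewrite /GRing.add/= subrK.
  by apply: is_cvgD => //; exact: is_cvg_cst.
apply: normed_cvg.
(* The constant c + 1 stands in for the square root of c, as c <= (c + 1)^2. *)
apply: (@series_le_cvg _ _ (geometric (c + 1) (2^-1))) => [n|n|n|].
- exact: normr_ge0.
- by rewrite /= mulr_ge0 ?exprn_ge0 ?invr_ge0 ?addr_ge0.
- rewrite /= /telescope /= exprVn -ler_pdivrMr ?invr_gt0 ?exprn_gt0// invrK.
  rewrite -(@ler_pXn2r _ 2) ?nnegrE ?mulr_ge0 ?exprn_ge0 ?addr_ge0//.
  rewrite exprMn real_normK ?num_real// -exprM mulnC exprM.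
  have -> : (2 : R) ^+ 2 = 4 by ring.
  apply: (@le_trans _ _ c); last by nra.
  apply: le_trans (h n); rewrite mulrC ler_wpM2r ?sqr_ge0//.
  by rewrite exprS ler_peMl ?exprn_ge0// ler1n.
by apply: is_cvg_geometric_series; rewrite ger0_norm ?invr_ge0// invf_lt1 ?ltr1n.
Qed.

Section L2.
Context d (X : measurableType d) (R : realType) (M : {measure set X -> \bar R}).
Local Notation C := R[i].
Implicit Types (F G H : X -> C) (f g : X -> R).

Definition cmeasurable F : Prop :=
  measurable_fun setT (fun x => complex.Re (F x)) /\
  measurable_fun setT (fun x => complex.Im (F x)).

(** The square of the usual norm, matching [hn]; it is allowed to be infinite. *)
Definition l2norm F : \bar R := (\int[M]_x (csq (F x))%:E)%E.

Definition l2fun F : Prop := cmeasurable F /\ (l2norm F < +oo)%E.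

Lemma measurable_csq F : cmeasurable F ->
  measurable_fun setT (fun x => (csq (F x))%:E).
Proof.
move=> [mr mi]; apply/measurable_EFinP; rewrite /csq.
by apply: measurable_funD; exact: measurable_funX.
Qed.
Local Hint Resolve measurable_csq : core.

Lemma cmeasurableD F G : cmeasurable F -> cmeasurable G ->
  cmeasurable (fun x => F x + G x).
Proof.
move=> [Fr Fi] [Gr Gi]; split.
  by under eq_fun do rewrite raddfD; exact: measurable_funD.
by under eq_fun do rewrite raddfD; exact: measurable_funD.
Qed.

Lemma cmeasurableM F G : cmeasurable F -> cmeasurable G ->
  cmeasurable (fun x => F x * G x).
Proof.
move=> [Fr Fi] [Gr Gi]; split.
  rewrite (_ : (fun _ => _) = (fun x => complex.Re (F x) * complex.Re (G x) -
     complex.Im (F x) * complex.Im (G x))).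
    by apply: measurable_funB; exact: measurable_funM.
  by apply/funext => x; case: (F x) (G x) => a b [].
rewrite (_ : (fun _ => _) = (fun x => complex.Re (F x) * complex.Im (G x) +
   complex.Im (F x) * complex.Re (G x))).
  by apply: measurable_funD; exact: measurable_funM.
by apply/funext => x; case: (F x) (G x) => a b [].
Qed.

Lemma cmeasurable_real f : measurable_fun setT f ->
  cmeasurable (fun x => (f x)%:C%C).
Proof. by move=> mf; split => //=; exact: measurable_cst. Qed.

Lemma cmeasurable_cst (a : C) : cmeasurable (fun=> a).
Proof. by split; exact: measurable_cst. Qed.

Lemma cmeasurableJ F : cmeasurable F -> cmeasurable (fun x => (F x)^*%C).
Proof.
move=> [Fr Fi]; split.
  rewrite (_ : (fun _ => _) = (fun x => complex.Re (F x)))//.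
  by apply/funext => x; case: (F x).
rewrite (_ : (fun _ => _) = (fun x => - complex.Im (F x))).
  exact: measurableT_comp.
by apply/funext => x; case: (F x).
Qed.

Lemma le_l2norm F G : cmeasurable F -> cmeasurable G ->
  (forall x, csq (F x) <= csq (G x)) -> (l2norm F <= l2norm G)%E.
Proof.
move=> mF mG FG; apply: ge0_le_integral => //; try exact: measurable_csq.
- by move=> x _; rewrite lee_fin csq_ge0.
- by move=> x _; rewrite lee_fin.
Qed.

Lemma l2norm_ge0 F : (0 <= l2norm F)%E.
Proof. by apply: integral_ge0 => x _; rewrite lee_fin csq_ge0. Qed.

Lemma l2normZ (a : C) F : cmeasurable F ->
  l2norm (fun x => a * F x) = ((csq a)%:E * l2norm F)%E.
Proof.
move=> mF; rewrite /l2norm; under eq_integral do rewrite csqM EFinM.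
rewrite ge0_integralZl_EFin ?csq_ge0//; last exact: measurable_csq.
by move=> x _; rewrite lee_fin csq_ge0.
Qed.

Lemma l2normD_le F G : cmeasurable F -> cmeasurable G ->
  (l2norm (fun x => F x + G x)%R <= 2%:E * l2norm F + 2%:E * l2norm G)%E.
Proof.
move=> mF mG; rewrite /l2norm.
have m2 H : cmeasurable H -> measurable_fun setT (fun x => (2%:E * (csq (H x))%:E)%E).
  by move=> mH; apply: measurable_funeM; exact: measurable_csq.
rewrite -!ge0_integralZl_EFin//; try exact: measurable_csq;
  try by move=> x _; rewrite lee_fin csq_ge0.
rewrite -ge0_integralD//; try exact: m2;
  try by move=> x _; rewrite -EFinM lee_fin mulr_ge0 ?csq_ge0.
apply: ge0_le_integral => //.
- by move=> x _; rewrite lee_fin csq_ge0.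
- exact/measurable_csq/cmeasurableD.
- by apply: emeasurable_funD; exact: m2.
- by move=> x _; rewrite -!EFinM -EFinD lee_fin csqD_le.
Qed.

Lemma l2funD F G : l2fun F -> l2fun G -> l2fun (fun x => F x + G x).
Proof.
move=> [mF fF] [mG fG]; split; first exact: cmeasurableD.
apply: le_lt_trans (l2normD_le mF mG) _.
by rewrite lte_add_pinfty// lte_mul_pinfty ?lee_fin ?l2norm_ge0.
Qed.

Lemma l2funZ (a : C) F : l2fun F -> l2fun (fun x => a * F x).
Proof.
move=> [mF fF]; split; first by apply: cmeasurableM => //; exact: cmeasurable_cst.
by rewrite l2normZ// lte_mul_pinfty ?lee_fin ?csq_ge0.
Qed.

Lemma l2fun0 : l2fun (fun=> 0).
Proof.
split; first exact: cmeasurable_cst.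
by rewrite /l2norm integral0_eq ?ltry// => x _; rewrite csq0.
Qed.

Definition l2pred : {pred (X -> C)} := fun F => `[< l2fun F >].

Lemma l2pred_submod : submod_closed l2pred.
Proof.
split; first by apply/asboolP; exact: l2fun0.
move=> a F G /asboolP hF /asboolP hG; apply/asboolP.
exact: l2funD (l2funZ a hF) hG.
Qed.

HB.instance Definition _ := GRing.isSubmodClosed.Build _ _ l2pred l2pred_submod.

(** Genuine functions rather than classes, so that evaluation at a point makes sense; null functions
    are divided out only in [L2]. *)
Definition L2T := {F : X -> C | F \in l2pred}.
HB.instance Definition _ := SubChoice.on L2T.
HB.instance Definition _ := [SubChoice_isSubLmodule of L2T by <:].

Definition cintegral F : C :=
  Complex (\int[M]_x complex.Re (F x))%R (\int[M]_x complex.Im (F x))%R.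

Definition cintegrable F : Prop :=
  M.-integrable setT (fun x => (complex.Re (F x))%:E) /\
  M.-integrable setT (fun x => (complex.Im (F x))%:E).

Lemma cintegral_linear (a : C) F G : cintegrable F -> cintegrable G ->
  cintegral (fun x => a * F x + G x) = a * cintegral F + cintegral G.
Proof.
case: a => u v [Fr Fi] [Gr Gi]; rewrite /cintegral.
have iZ c f : M.-integrable setT (EFin \o f) ->
    M.-integrable setT (EFin \o (fun x => c * f x)).
  by move=> hf; have := integrableZl measurableT c hf; under eq_fun do rewrite -EFinM.
have iD f g : M.-integrable setT (EFin \o f) -> M.-integrable setT (EFin \o g) ->
    M.-integrable setT (EFin \o (fun x => f x + g x)).
  by move=> hf hg; apply: eq_integrable (integrableD measurableT hf hg).
have -> : (fun x => complex.Re ((u +i* v)%C * F x + G x)) = (fun x =>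
    u * complex.Re (F x) + (- v) * complex.Im (F x) + complex.Re (G x)).
  by apply/funext => x; case: (F x) (G x) => p q [] p' q' /=; rewrite mulNr.
have -> : (fun x => complex.Im ((u +i* v)%C * F x + G x)) = (fun x =>
    u * complex.Im (F x) + v * complex.Re (F x) + complex.Im (G x)).
  by apply/funext => x; case: (F x) (G x) => p q [].
rewrite !RintegralD//; try exact: iZ; try (apply: iD; exact: iZ).
rewrite !RintegralZl//.
by apply/eqP; rewrite eq_complex/=; apply/andP; split; apply/eqP; ring.
Qed.

Lemma cintegralJ F : cintegrable F ->
  cintegral (fun x => (F x)^*%C) = (cintegral F)^*%C.
Proof.
move=> [Fr Fi]; rewrite /cintegral /=; congr Complex.
  by apply: eq_Rintegral => x _; case: (F x).
rewrite (_ : (fun _ => _) = (fun x => (- 1) * complex.Im (F x))).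
  by rewrite RintegralZl// mulN1r.
by apply/funext => x; case: (F x) => p q /=; rewrite mulN1r.
Qed.

(** The real and imaginary parts of the product are bounded by csq (F x) + csq (G x). *)
Lemma cintegrable_mulJ F G : l2fun F -> l2fun G ->
  cintegrable (fun x => F x * (G x)^*%C).
Proof.
move=> [mF fF] [mG fG].
have [mr mi] := cmeasurableM mF (cmeasurableJ mG).
have i1 : M.-integrable setT (fun x => (csq (F x) + csq (G x))%:E).
  have i1 H : cmeasurable H -> (l2norm H < +oo)%E ->
      M.-integrable setT (fun x => (csq (H x))%:E).
    move=> mH fH; apply/integrableP; split; first exact: measurable_csq.
    under eq_integral do rewrite gee0_abs ?lee_fin ?csq_ge0//.
    exact: fH.
  by under eq_fun do rewrite EFinD; apply: integrableD => //; exact: i1.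
split; apply: le_integrable i1 => //; try exact/measurable_EFinP.
  move=> x _; rewrite lee_fin [leRHS]ger0_norm ?(addr_ge0 (csq_ge0 _) (csq_ge0 _))//.
  case: (F x) (G x) => a b [c e]; rewrite /csq/= ler_norml.
  have := sqr_ge0 (a - c); have := sqr_ge0 (a + c).
  have := sqr_ge0 (b - e); have := sqr_ge0 (b + e) => h1 h2 h3 h4.
  have := sqr_ge0 a; have := sqr_ge0 b; have := sqr_ge0 c; have := sqr_ge0 e.
  by move=> h5 h6 h7 h8; apply/andP; split; lra.
move=> x _; rewrite lee_fin [leRHS]ger0_norm ?(addr_ge0 (csq_ge0 _) (csq_ge0 _))//.
case: (F x) (G x) => a b [c e]; rewrite /csq/= ler_norml.
have := sqr_ge0 (a - e); have := sqr_ge0 (a + e).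
have := sqr_ge0 (b - c); have := sqr_ge0 (b + c) => h1 h2 h3 h4.
have := sqr_ge0 a; have := sqr_ge0 b; have := sqr_ge0 c; have := sqr_ge0 e.
by move=> h5 h6 h7 h8; apply/andP; split; lra.
Qed.

Lemma L2P (F : L2T) : l2fun (val F).
Proof. by apply/asboolP; exact: (valP F). Qed.

Definition mkL2 F (hF : l2fun F) : L2T := exist _ F (asboolT hF).

Definition l2ip (F G : L2T) : C := cintegral (fun x => val F x * (val G x)^*%C).

Lemma l2ip_norm (F : L2T) : (hn l2ip F)%:E = l2norm (val F).
Proof.
have [mF fF] := L2P F.
have E x : complex.Re (val F x * (val F x)^*%C) = csq (val F x).
  by case: (val F x) => a b; rewrite /csq/=; ring.
rewrite /hn /l2ip /cintegral [complex.Re _]/=; under eq_Rintegral do rewrite E.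
by rewrite /Rintegral fineK// ge0_fin_numE// l2norm_ge0.
Qed.

Lemma l2ip_semi : semi_inner_product l2ip.
Proof.
split.
- move=> a F G H; rewrite /l2ip -cintegral_linear.
  + by congr cintegral; apply/funext => x; rewrite mulrDl -mulrA.
  + by apply: cintegrable_mulJ; exact: L2P.
  + by apply: cintegrable_mulJ; exact: L2P.
- move=> F G; rewrite cconjE /l2ip -cintegralJ.
    by congr cintegral; apply/funext => x; rewrite rmorphM/= conjcK mulrC.
  by apply: cintegrable_mulJ; exact: L2P.
- by move=> F; rewrite -lee_fin l2ip_norm l2norm_ge0.
Qed.

Lemma ae_eq_l2norm F G : cmeasurable F -> cmeasurable G ->
  {ae M, forall x, F x = G x} -> l2norm F = l2norm G.
Proof.
move=> mF mG FG; apply: ge0_ae_eq_integral => //; try exact: measurable_csq;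
  try by move=> x _; rewrite lee_fin csq_ge0.
by apply: filterS FG => x /= -> _.
Qed.

Lemma l2norm_eq0 F : cmeasurable F -> l2norm F = 0%E ->
  {ae M, forall x, F x = 0}.
Proof.
move=> mF F0; have [+ _] := ae_eq_integral_abs M measurableT (measurable_csq mF).
rewrite (_ : (\int[M]_x _)%E = 0%E).
  by move=> /(_ erefl); apply: filterS => x /= /(_ I) [] /csq_eq0.
rewrite -[RHS]F0; apply: eq_integral => x _.
by rewrite gee0_abs// lee_fin csq_ge0.
Qed.

(** Riesz-Fischer: a subsequence with fast decreasing increments converges almost everywhere, and
    Fatou's lemma shows that the pointwise limit is also the limit in the mean. *)
Lemma l2_complete (u : nat -> L2T) : hcauchy l2ip u ->
  exists l, hconverges l2ip u l.
Proof.
move=> uC.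
have e8 k : 0 < (8^-1 : R) ^+ k.+1 by rewrite exprn_gt0.
have [N hN] := choice (fun k => uC _ (e8 k)).
(* A sum rather than [N k] alone, so that [n k] dominates every [N i] with i <= k. *)
pose n k := (\sum_(i < k.+1) N i)%N.
have Nn i k : (i <= k)%N -> (N i <= n k)%N.
  by move=> ik; rewrite /n (bigD1 (Ordinal (ik : (i < k.+1)%N)))//= leq_addr.
pose F k : X -> C := val (u (n k)).
have mF k : cmeasurable (F k) by have [] := L2P (u (n k)).
have mFB (k m : nat) : cmeasurable (fun x => F k x - val (u m) x).
  by have [] := L2P (u (n k) - u m).
(* The weight 4^(k+1) feeds [cvg_fast_increments]; against increments below 8^-(k+1) it leaves the
   summable 2^-(k+1). *)
pose D k x := (4 ^+ k.+1 * csq (F k.+1 x - F k x))%:E.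
have mD k : measurable_fun setT (D k).
  rewrite /D; under eq_fun do rewrite EFinM.
  by apply: measurable_funeM; exact/measurable_csq/mFB.
have D0 k x : (0 <= D k x)%E by rewrite lee_fin mulr_ge0 ?csq_ge0 ?exprn_ge0.
have intD : (\int[M]_x (\sum_(k <oo) D k x) < +oo)%E.
  rewrite integral_nneseries//.
  apply: (@le_lt_trans _ _ (\sum_(k <oo) (1 / (2 ^ k.+1)%:R)%:E)%E); last first.
    by apply: le_lt_trans (epsilon_trick0 xpredT (@ler01 R)) _; rewrite ltry.
  apply: lee_nneseries => // k _ /=; first by move=> _; exact: integral_ge0.
  rewrite /D; under eq_integral do rewrite EFinM.
  rewrite ge0_integralZl_EFin ?exprn_ge0//; try exact/measurable_csq/mFB;
    try by move=> x _; rewrite lee_fin csq_ge0.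
  rewrite -/(l2norm _) -(l2ip_norm (u (n k.+1) - u (n k))) -EFinM lee_fin.
  have := hN k (n k.+1) (n k) (Nn _ _ (leqnSn k)) (Nn _ _ (leqnn k)).
  move=> /ltW h; apply: (@le_trans _ _ (4 ^+ k.+1 * 8^-1 ^+ k.+1)).
    by rewrite ler_wpM2l// exprn_ge0.
  by rewrite -exprMn natrX div1r (_ : 4 * 8^-1 = 2^-1) ?exprVn//; lra.
have aeD : {ae M, forall x, (\sum_(k <oo) D k x < +oo)%E}.
  have : M.-integrable setT (fun x => (\sum_(k <oo) D k x)%E).
    apply/integrableP; split; first exact: ge0_emeasurable_sum.
    by under eq_integral do rewrite gee0_abs ?nneseries_ge0//.
  move=> /(integrable_ae measurableT); apply: filterS => x /(_ I).
  by rewrite fin_numE ltey => /andP[].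
have cvgF x : (\sum_(k <oo) D k x < +oo)%E ->
    cvgn (fun k => complex.Re (F k x)) /\ cvgn (fun k => complex.Im (F k x)).
  move=> fx; have s0 : (0 <= \sum_(k <oo) D k x)%E by exact: nneseries_ge0.
  have Dle k : 4 ^+ k.+1 * csq (F k.+1 x - F k x) <= fine (\sum_(k <oo) D k x)%E.
    rewrite -lee_fin fineK ?ge0_fin_numE//.
    rewrite -/(D k x) (nneseries_split 0 k.+1)// add0n.
    rewrite big_nat_recr//= -addeA [leRHS]addeC -addeA leeDl//.
    by rewrite adde_ge0 ?sume_ge0 ?nneseries_ge0.
  split; apply: cvg_fast_increments => k; apply: le_trans (Dle k);
    rewrite ler_wpM2l ?exprn_ge0// -raddfB; rewrite /csq.
    by rewrite lerDl sqr_ge0.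
  by rewrite lerDr sqr_ge0.
(* The upper limit is measurable without removing an exceptional set, and agrees with the limit
   wherever that exists; [fine] only makes it real-valued. *)
pose lim1 (f : nat -> X -> R) x := fine (limn_esup (fun k => (f k x)%:E)).
pose G x : C := Complex (lim1 (fun k x => complex.Re (F k x)) x)
                        (lim1 (fun k x => complex.Im (F k x)) x).
have mlim1 (f : nat -> X -> R) : (forall k, measurable_fun setT (f k)) ->
    measurable_fun setT (lim1 f).
  move=> mf; apply: measurableT_comp; first exact: fine_measurable.
  by apply: measurable_fun_limn_esup => k; exact/measurable_EFinP.
have mG : cmeasurable G.
  by split; apply: mlim1 => k; have [] := mF k.
have cvgE (v : nat -> R) l : v @ \oo --> l -> (fun k => (v k)%:E) @ \oo --> l%:E.
  by move=> vl; apply: cvg_EFin => //; exact: nearW.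
have lim1E (f : nat -> X -> R) x : cvgn (fun k => f k x) ->
    (fun k => f k x) @ \oo --> lim1 f x.
  by move=> cf; rewrite /lim1 (cvg_limn_einf_sup (cvgE _ _ cf)).2.
(* Fatou's lemma in k with m fixed. It serves both to place [G] in L^2 and to estimate its distance
   to [u m]. *)
have fatouF m (e : R) : (\forall k \near \oo, hn l2ip (u (n k) - u m) <= e) ->
    (l2norm (fun x => G x - val (u m) x)%R <= e%:E)%E.
  move=> he.
  have mB k : cmeasurable (fun x => F k x - val (u m) x).
    by have [] := L2P (u (n k) - u m).
  have mGm : cmeasurable (fun x => G x - val (u m) x).
    apply: cmeasurableD => //.
    by have [] := L2P (- u m).
  have -> : l2norm (fun x => G x - val (u m) x) =
      (\int[M]_x limn_einf (fun k => (csq (F k x - val (u m) x))%:E))%E.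
    apply: ae_eq_integral => //; first exact: measurable_csq.
      apply: (emeasurable_fun_cvg (fun k x =>
        einfs (fun k => (csq (F k x - val (u m) x))%:E) k)) => [k|x _].
        by apply: measurable_fun_einfs => i; exact: measurable_csq.
      by rewrite limn_einf_lim; exact: is_cvg_einfs.
    apply: filterS aeD => x /cvgF[hr hi] _ /=; symmetry.
    have cr := lim1E (fun k x => complex.Re (F k x)) x hr.
    have ci := lim1E (fun k x => complex.Im (F k x)) x hi.
    apply: (cvg_limn_einf_sup _).1; apply: cvgE; rewrite /csq.
    under eq_fun do rewrite !raddfB; rewrite !raddfB/=.
    by apply: cvgD; apply: cvgM; apply: cvgB => //; exact: cvg_cst.
  apply: le_trans (fatou _ _ _ _) _ => //.
  - by move=> k; exact: measurable_csq.
  - by move=> k x _; rewrite lee_fin csq_ge0.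
  rewrite limn_einf_lim; apply: lime_le; first exact: is_cvg_einfs.
  apply: filterS he => k he; apply: (@le_trans _ _ (hn l2ip (u (n k) - u m))%:E).
    by rewrite l2ip_norm; apply: ereal_inf_lbound; exists k => //=.
  by rewrite lee_fin.
have near0 k m : (N k <= m)%N ->
    (l2norm (fun x => G x - val (u m) x)%R <= (8^-1 ^+ k.+1)%:E)%E.
  move=> km; apply: fatouF; exists k => // i /= ki.
  by apply/ltW/hN => //; exact: Nn.
have l2G : l2fun G.
  split => //.
  have h0 : l2fun (fun x => G x - val (u (N 0%N)) x).
    split; last by apply: le_lt_trans (near0 0%N _ (leqnn _)) _; rewrite ltry.
    by apply: cmeasurableD => //; have [] := L2P (- u (N 0%N)).
  have := (l2funD h0 (L2P (u (N 0%N)))).2.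
  by under eq_fun do rewrite subrK.
exists (mkL2 l2G) => e e0.
have [k hk] : exists k, (8^-1 : R) ^+ k.+1 < e.
  have [k /(_ k (leqnn k)) h] := invS_lt e0; exists k; apply: le_lt_trans h.
  rewrite exprVn lef_pV2 ?posrE ?exprn_gt0// -natrX ler_nat.
  exact/ltnW/ltn_expl.
exists (N k) => m Nm; rewrite (hnBC l2ip_semi); apply: le_lt_trans hk.
by rewrite -lee_fin l2ip_norm; exact: near0.
Qed.

End L2.

(** * Multiplication operators *)

Section L2Hilbert.
Context d (X : measurableType d) (R : realType) (M : {measure set X -> \bar R}).
Local Notation C := R[i].

Definition L2 := hquot (l2ip_semi M).
HB.instance Definition _ := GRing.Lmodule.on L2.

Definition l2class (F : L2T M) : L2 := hpi (l2ip_semi M) F.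

Definition L2ip (p q : L2) : C := hq_ip p q.

Lemma L2_hilbert : is_hilbert L2ip.
Proof. apply: hquot_hilbert; exact: l2_complete. Qed.

Lemma l2class_linear (a : C) F G :
  l2class (a *: F + G) = a *: l2class F + l2class G.
Proof. exact: hpi_linear. Qed.

Lemma l2classB F G : l2class (F - G) = l2class F - l2class G.
Proof. exact: hpiB. Qed.

Lemma l2classP (p : L2) : exists F, p = l2class F.
Proof. exact: hquotP. Qed.

Lemma L2ipE F G : L2ip (l2class F) (l2class G) = l2ip F G.
Proof. exact: hq_ipE. Qed.

Lemma hn_l2class F : (hn L2ip (l2class F))%:E = l2norm M (val F).
Proof. by rewrite -l2ip_norm /hn L2ipE. Qed.

Lemma l2class_eq F G : l2class F = l2class G <-> {ae M, forall x, val F x = val G x}.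
Proof.
have [mFG _] := L2P (F - G).
split=> [/hpiP h|h].
  have : l2norm M (val (F - G)) = 0%E by rewrite -l2ip_norm h.
  by move=> /(l2norm_eq0 mFG); apply: filterS => x /eqP; rewrite subr_eq0 => /eqP.
apply/hpiP/EFin_inj; rewrite l2ip_norm (ae_eq_l2norm (G := fun=> 0))//.
- by rewrite /l2norm integral0_eq// => x _; rewrite csq0.
- by apply: filterS h => x h; rewrite [LHS](_ : _ = val F x - val G x)// h subrr.
Qed.

Lemma l2fun_bounded (m : X -> R) (c : R) (F : X -> C) :
  measurable_fun setT m -> (forall x, `|m x| <= c) -> l2fun M F ->
  l2fun M (fun x => (m x)%:C%C * F x).
Proof.
move=> mm mc [mF fF].
have mmF : cmeasurable (fun x => (m x)%:C%C * F x).
  by apply: cmeasurableM => //; exact: cmeasurable_real.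
split=> //; apply: le_lt_trans (l2funZ c%:C%C (conj mF fF)).2.
apply: le_l2norm => //; first by apply: cmeasurableM => //; exact: cmeasurable_cst.
move=> x; rewrite !csqM !csqR ler_wpM2r ?csq_ge0//.
by rewrite -(real_normK (num_real (m x))) lerXn2r ?nnegrE// (le_trans _ (mc x)).
Qed.

Section Multiplication.
Variable a : X -> R.
Hypothesis ma : measurable_fun setT a.

(** The equation holds everywhere for suitable representatives, not just almost everywhere. The
    domain is maximal: all classes of F with a F square integrable. *)
Definition mult_op : set (L2 * L2) :=
  [set p | exists F G : L2T M, [/\ p.1 = l2class F, p.2 = l2class G &
    forall x, val G x = (a x)%:C%C * val F x]].

(** Cutoffs making [a] bounded. They tend to 1 pointwise, being equal to 1 from some n on. *)
Let chi (n : nat) (x : X) : R := \1_[set x | `|a x| <= n%:R] x.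

Let mchi n : measurable_fun setT (chi n).
Proof.
apply: measurable_indic; rewrite -[X in measurable X]setTI.
by apply: measurable_fun_le => //; exact: measurableT_comp.
Qed.

Let chi1 n x : `|a x| <= n%:R -> chi n x = 1.
Proof. by move=> h; rewrite /chi indicE mem_set. Qed.

Let chi_le1 n x : `|chi n x| <= 1.
Proof. by rewrite /chi indicE; case: (_ \in _); rewrite ?normr0 ?normr1. Qed.

Let chi_idem n x : chi n x * chi n x = chi n x.
Proof. by rewrite /chi indicE; case: (_ \in _); rewrite ?mulr1 ?mulr0. Qed.

Let achi_le n x : `|a x * chi n x| <= n%:R.
Proof.
rewrite /chi indicE; have [/set_mem/= h|_] := boolP (_ \in _).
  by rewrite mulr1.
by rewrite mulr0 normr0.
Qed.

Let machi n : measurable_fun setT (fun x => a x * chi n x).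
Proof. exact: measurable_funM. Qed.

Let chi_near x : exists n, forall k, (n <= k)%N -> chi k x = 1.
Proof.
exists (Num.truncn `|a x|).+1 => k nk; apply: chi1.
by apply: ltW; apply: lt_le_trans (truncnS_gt _) _; rewrite ler_nat.
Qed.

Lemma mult_op_linear : op_linear mult_op.
Proof.
have l0 : (0 : L2) = l2class 0 by [].
split; first by exists 0, 0; split=> // x; rewrite mulr0.
move=> c x y x' y' [F [G [+ + FG]]] [F' [G' [+ + FG']]] => /= -> -> -> ->.
exists (c *: F + F'), (c *: G + G'); split; rewrite ?l2class_linear// => t.
rewrite [LHS](_ : _ = c * val G t + val G' t)//.
by rewrite [X in _ = _ * X](_ : _ = c * val F t + val F' t)// FG FG' mulrDr mulrCA.
Qed.

Lemma mult_op_single_valued : op_single_valued mult_op.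
Proof.
move=> x y y' [F [G [+ + FG]]] [F' [G' [+ + FG']]].
move=> /= -> -> /l2class_eq FF' ->.
by apply/l2class_eq; apply: filterS FF' => t h; rewrite FG FG' h.
Qed.

(** The truncations [chi n] F lie in the domain and tend to F by dominated convergence, with
    dominating function |F|^2. *)
Lemma mult_op_dense : op_densely_defined L2ip mult_op.
Proof.
move=> p e e0; have [F ->] := l2classP p; have [mF fF] := L2P F.
have h1 n := l2fun_bounded (mchi n) (chi_le1 n) (L2P F).
have h2 n := l2fun_bounded (machi n) (achi_le n) (L2P F).
suff [n hn] : exists n,
    (l2norm M (fun x => val F x - (chi n x)%:C%C * val F x)%R < e%:E)%E.
  exists (l2class (mkL2 (h1 n))); split.
    exists (l2class (mkL2 (h2 n))), (mkL2 (h1 n)), (mkL2 (h2 n)); split=> // x /=.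
    by rewrite mulrA -rmorphM.
  by rewrite -lte_fin -[_ - _]hpiB -/(l2class _) hn_l2class.
pose f_ n x := (csq (val F x - (chi n x)%:C%C * val F x))%:E.
have mf n : measurable_fun setT (f_ n).
  apply: measurable_csq; apply: cmeasurableD => //.
  by have [] := L2P (- mkL2 (h1 n)).
have : (fun n => \int[M]_x f_ n x)%E @ \oo --> (\int[M]_x (cst 0 x))%E.
  apply: (@dominated_cvg _ _ _ _ _ _ f_ (cst 0%E) (fun x => (csq (val F x))%:E)) => //.
  - move=> x _; have [n hn] := chi_near x.
    apply: cvg_near_cst; exists n => // k /= /hn hk.
    by rewrite /f_ hk mul1r subrr csq0.
  - apply/integrableP; split; first exact: measurable_csq.
    under eq_integral do rewrite gee0_abs ?lee_fin ?csq_ge0//.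
    exact: fF.
  - move=> n x _; rewrite gee0_abs ?lee_fin ?csq_ge0//.
    rewrite (_ : _ - _ = (1 - chi n x)%:C%C * val F x); last first.
      by rewrite rmorphB rmorph1 mulrBl mul1r.
    rewrite csqM csqR ler_piMl ?csq_ge0//.
    rewrite /chi indicE; case: (_ \in _) => /=; rewrite ?subrr ?subr0 ?expr0n ?expr1n//.
rewrite integral_cst// mul0e => /fine_cvgP[[N1 _ fin]] /cvgrPdist_lt/(_ _ e0)[N2 _ h].
exists (maxn N1 N2); have /= := fin _ (leq_maxl N1 N2) => fi.
have /= := h _ (leq_maxr N1 N2); rewrite sub0r normrN => h'.
rewrite -[ltLHS]fineK// lte_fin; apply: le_lt_trans h'; exact: ler_norm.
Qed.

(** Symmetry holds because [a] is real. Conversely, if (Y, Z) is in the adjoint, testing against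
    truncations of a Y - Z shows that a Y = Z almost everywhere, hence that a Y is square
    integrable. *)
Lemma mult_op_selfadjoint : op_adjoint L2ip mult_op = mult_op.
Proof.
apply/seteqP; split=> [[p q]|[p q]] /=; last first.
  move=> [Y [Z [+ + YZ]]] => /= -> -> x y [F [G [+ + FG]]] => /= -> ->.
  rewrite !L2ipE /l2ip; congr cintegral; apply/funext => t.
  by rewrite FG YZ conjc_realM mulrCA mulrA.
have [Y ->] := l2classP p; have [Z ->] := l2classP q => h.
have maY : cmeasurable (fun x => (a x)%:C%C * val Y x).
  by apply: cmeasurableM; [exact: cmeasurable_real|have [] := L2P Y].
suff aYZ : {ae M, forall x, (a x)%:C%C * val Y x = val Z x}.
  have [mZ fZ] := L2P Z.
  have laY : l2fun M (fun x => (a x)%:C%C * val Y x).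
    by split=> //; rewrite (ae_eq_l2norm maY mZ aYZ).
  exists Y, (mkL2 laY); split=> //.
  by apply/l2class_eq; apply: filterS aYZ => x <-.
suff hn n : {ae M, forall x, (chi n x)%:C%C * ((a x)%:C%C * val Y x - val Z x) = 0}.
  apply: filterS (ae_foralln hn) => x hx; have [n hc] := chi_near x.
  by have := hx n; rewrite hc// mul1r => /eqP; rewrite subr_eq0 => /eqP.
(* The truncation is essential: a Y is not yet known to be square integrable. *)
have lH : l2fun M (fun x => (chi n x)%:C%C * ((a x)%:C%C * val Y x - val Z x)).
  have hY := l2fun_bounded (machi n) (achi_le n) (L2P Y).
  have hZ := l2fun_bounded (mchi n) (chi_le1 n) (L2P Z).
  have := l2funD hY (l2funZ (-1) hZ); congr l2fun; apply/funext => x.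
  by rewrite mulN1r mulrBr mulrA -rmorphM/= mulrC [a x * _]mulrC mulrC.
pose H := mkL2 lH.
have lK := l2fun_bounded (machi n) (achi_le n) lH.
have KH x : val (mkL2 lK) x = (a x)%:C%C * val H x.
  by rewrite /= rmorphM/= -mulrA; congr (_ * _); rewrite mulrA -rmorphM/= chi_idem.
have := h (l2class H) (l2class (mkL2 lK)).
have inA : mult_op (l2class H, l2class (mkL2 lK)) by exists H, (mkL2 lK).
move=> /(_ inA); rewrite !L2ipE => E.
(* As [chi n] is idempotent, <H,H> = <H, a Y - Z> = <a H, Y> - <H, Z>, which vanishes by the adjoint
   relation at the pair (H, a H). *)
have H0 : l2ip H H = 0.
  rewrite [RHS](_ : _ = -1 * l2ip H Z + l2ip (mkL2 lK) Y); last first.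
    by rewrite E mulN1r addNr.
  rewrite /l2ip -cintegral_linear; try (by apply: cintegrable_mulJ; exact: L2P).
  congr cintegral; apply/funext => x; rewrite KH.
  have -> : val H x * (val H x)^*%C =
      val H x * ((a x)%:C%C * val Y x - val Z x)^*%C.
    rewrite /= conjc_realM mulrCA !mulrA -[in LHS]rmorphM/= chi_idem.
    by rewrite -!mulrA.
  have cB (u v : C) : conjc (u - v) = conjc u - conjc v by exact: rmorphB.
  rewrite cB conjc_realM mulrBr mulN1r [RHS]addrC; congr (_ - _).
  by rewrite mulrCA mulrA.
have [mH _] := L2P H.
apply: (l2norm_eq0 mH).
by rewrite -l2ip_norm /hn H0.
Qed.

End Multiplication.
End L2Hilbert.

(** * Integrals determined by their values on indicators *)

Section EsumMonotone.
Context (R : realType) (T : choiceType).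
Local Open Scope ereal_scope.

Lemma ge0_esumZl (S : set T) (k : R) (f : T -> \bar R) :
  (0 <= k)%R -> (forall i, 0 <= f i) ->
  \esum_(i in S) (k%:E * f i) = k%:E * \esum_(i in S) f i.
Proof.
move=> k0 f0; rewrite /esum -ereal_supZl//; last first.
  apply/eqP => /seteqP[/(_ 0) + _]; apply; exists set0; last by rewrite fsbig_set0.
  exact: fsets_set0.
rewrite image_comp; congr ereal_sup; apply: eq_imagel => A _ /=.
by rewrite ge0_mule_fsumr.
Qed.

(** Monotone convergence for sums over an arbitrary index set: finite partial sums commute with the
    limit, and each is bounded by the full sum at the same n. *)
Lemma esum_lim (S : set T) (f : nat -> T -> \bar R) :
  (forall n i, 0 <= f n i) -> (forall i, {homo f ^~ i : m n / (m <= n)%N >-> m <= n}) ->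
  \esum_(i in S) limn (f ^~ i) = limn (fun n => \esum_(i in S) f n i).
Proof.
move=> f0 fnd.
have cf i : cvgn (f ^~ i) by exact: ereal_nondecreasing_is_cvgn.
have ndS : {homo (fun n => \esum_(i in S) f n i) : m n / (m <= n)%N >-> m <= n}.
  by move=> m n mn; apply: le_esum => i _; exact: fnd.
have cS := ereal_nondecreasing_is_cvgn ndS.
apply/eqP; rewrite eq_le; apply/andP; split; last first.
  apply: lime_le => //; apply: nearW => n; apply: le_esum => i _.
  apply: lime_ge => //; exists n => // m /= nm; exact: fnd.
apply: ub_ereal_sup => _ [A [finA AS] <-]; rewrite fsbig_finite//.
have /cvg_lim <-// : (fun n => \sum_(i <- finmap.enum_fset (fset_set A)) f n i) @ \oo -->
    \sum_(i <- finmap.enum_fset (fset_set A)) limn (f ^~ i).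
  by apply: cvg_nnesum => i _; [exact: nearW|exact: cf].
apply: lee_lim => //.
  apply: ereal_nondecreasing_is_cvgn => m n mn; apply: lee_sum => i _; exact: fnd.
apply: nearW => n; apply: esum_ge; exists A; first by split.
by rewrite fsbig_finite.
Qed.

End EsumMonotone.

Section IntegralUnique.
Context d (X : measurableType d) (R : realType) (m : {measure set X -> \bar R}).
Variable I : (X -> \bar R) -> \bar R.
Local Open Scope ereal_scope.

Hypothesis I_indic : forall A, measurable A -> I (fun x => (\1_A x)%:E) = m A.
Hypothesis IZ : forall (k : R) f, (0 <= k)%R -> measurable_fun setT f ->
  (forall x, 0 <= f x) -> I (fun x => k%:E * f x) = k%:E * I f.
Hypothesis ID : forall f g, measurable_fun setT f -> measurable_fun setT g ->
  (forall x, 0 <= f x) -> (forall x, 0 <= g x) ->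
  I (fun x => f x + g x) = I f + I g.
Hypothesis I_lim : forall f : nat -> X -> \bar R,
  (forall n, measurable_fun setT (f n)) -> (forall n x, 0 <= f n x) ->
  (forall x, {homo f ^~ x : m n / (m <= n)%N >-> m <= n}) ->
  I (fun x => limn (f ^~ x)) = limn (fun n => I (f n)).

(** Agreement on indicators extends to simple functions by additivity and homogeneity, then to
    increasing limits. It yields both the slicewise formula for integrals and the change of
    variables behind the isometry. *)
Lemma ge0_integral_unique f : measurable_fun setT f -> (forall x, 0 <= f x) ->
  \int[m]_x f x = I f.
Proof.
move=> mf f0; pose g n := nnsfun_approx measurableT mf n.
(* Absolute values make all coefficients nonnegative without a side condition; the values of [g n]
   are nonnegative, so nothing changes there. *)
have ms (r : seq R) (A : R -> set X) : (forall i, measurable (A i)) ->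
    measurable_fun setT (fun x => (\sum_(i <- r) `|i|%:E * (\1_(A i) x)%:E)%E).
  move=> mA; apply: emeasurable_sum => i; apply: measurable_funeM.
  exact/measurable_EFinP/measurable_indic.
have Isum (r : seq R) (A : R -> set X) : (forall i, measurable (A i)) ->
    I (fun x => \sum_(i <- r) `|i|%:E * (\1_(A i) x)%:E) =
    \sum_(i <- r) `|i|%:E * m (A i).
  move=> mA; elim: r => [|i r IHr].
    (* The zero function is handled as 0 times the indicator of the empty set. *)
    rewrite big_nil -[RHS](mul0e (m set0)) -(I_indic measurable0) -IZ//.
      by congr I; apply/funext => x; rewrite big_nil mul0e.
    exact/measurable_EFinP/measurable_indic.
  have m1 : measurable_fun setT (fun x => `|i|%:E * (\1_(A i) x)%:E).
    by apply: measurable_funeM; exact/measurable_EFinP/measurable_indic.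
  under eq_fun do rewrite big_cons.
  rewrite big_cons -IHr -(I_indic (mA i)) ID ?IZ//.
  - exact/measurable_EFinP/measurable_indic.
  - exact: ms.
  - by move=> x; apply: sume_ge0 => j _; rewrite -EFinM lee_fin mulr_ge0.
have msum (r : seq R) (A : R -> set X) : (forall i, measurable (A i)) ->
    \int[m]_x (\sum_(i <- r) `|i|%:E * (\1_(A i) x)%:E) =
    \sum_(i <- r) `|i|%:E * m (A i).
  move=> mA; rewrite ge0_integral_sum//.
  - apply: eq_bigr => i _; rewrite ge0_integralZl_EFin//.
      by rewrite integral_indic// setIT.
    exact/measurable_EFinP/measurable_indic.
  - by move=> i; apply: measurable_funeM; exact/measurable_EFinP/measurable_indic.
have gE n : (fun x => (g n x)%:E) = (fun x =>
    \sum_(i <- finmap.enum_fset (fset_set (range (g n))))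
    `|i|%:E * (\1_(g n @^-1` [set i]) x)%:E).
  apply/funext => x; rewrite fimfunE fsbig_finite//= -sumEFin.
  rewrite big_seq [RHS]big_seq; apply: eq_bigr => i.
  rewrite in_fset_set// => /set_mem[t _ <-].
  by rewrite EFinM ger0_norm.
have gf x : f x = limn (fun n => (g n x)%:E).
  apply/esym/cvg_lim => //; exact: cvg_nnsfun_approx.
have mg n : measurable_fun setT (fun x => (g n x)%:E) by exact/measurable_EFinP.
have g0 n x : 0 <= (g n x)%:E by rewrite lee_fin.
have gnd x : {homo (fun n => (g n x)%:E) : m n / (m <= n)%N >-> m <= n}.
  by move=> a b ab; rewrite lee_fin; exact/lefP/nd_nnsfun_approx.
rewrite (_ : f = fun x => limn (fun n => (g n x)%:E)); last exact/funext.
rewrite monotone_convergence// (I_lim mg g0 gnd).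
by congr (limn _); apply/funext => n; rewrite gE msum// Isum.
Qed.

End IntegralUnique.

(** * The sum of the measures over the slices *)

(* [None] only serves to make the type pointed when [V] is empty; it carries
   no mass. *)
Definition sliced (V : choiceType) (R : realType) : Type := (option V * R)%type.

Section Sliced.
Context (V : choiceType) (R : realType).
Local Notation X := (sliced V R).

HB.instance Definition _ := gen_eqMixin X.
HB.instance Definition _ := gen_choiceMixin X.
HB.instance Definition _ := isPointed.Build X (None, 0).

Definition slice (v : V) (A : set X) : set R := [set t | A (Some v, t)].

(** No condition links different slices, so any function of the vertex alone is measurable, whatever
    the cardinality of [V]. *)
Definition sliced_measurable (A : set X) : Prop := forall v, measurable (slice v A).

Let sliced_measurable0 : sliced_measurable set0.
Proof. by move=> v; rewrite (_ : slice v set0 = set0)//. Qed.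

Let sliced_measurableC A : sliced_measurable A -> sliced_measurable (~` A).
Proof.
by move=> mA v; rewrite (_ : slice v (~` A) = ~` slice v A)//; exact: measurableC.
Qed.

Let sliced_measurable_bigcup (F : (set X)^nat) :
  (forall i, sliced_measurable (F i)) -> sliced_measurable (\bigcup_i F i).
Proof.
move=> mF v; rewrite (_ : slice v _ = \bigcup_i slice v (F i))//.
by apply: bigcupT_measurable => i; exact: mF.
Qed.

HB.instance Definition _ := @isMeasurable.Build default_measure_display X
  sliced_measurable sliced_measurable0 sliced_measurableC sliced_measurable_bigcup.

Lemma measurable_fun_sliced d (Y : measurableType d) (f : X -> Y) :
  (forall v, measurable_fun setT (fun t => f (Some v, t))) -> measurable_fun setT f.
Proof.
move=> mf _ B mB; rewrite setTI -[measurable _]/(sliced_measurable _) => v.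
by have := mf v measurableT B mB; rewrite setTI.
Qed.

Lemma measurable_slice d (Y : measurableType d) (f : X -> Y) (v : V) :
  measurable_fun setT f -> measurable_fun setT (fun t => f (Some v, t)).
Proof.
move=> mf _ B mB; rewrite setTI.
have : sliced_measurable (setT `&` f @^-1` B) := mf measurableT B mB.
by rewrite setTI; exact.
Qed.

Variable mu : V -> probability R R.
Local Open Scope ereal_scope.

Definition sliced_sum (A : set X) : \bar R := \esum_(v in [set: V]) mu v (slice v A).

Let sliced_sum0 : sliced_sum set0 = 0.
Proof. by rewrite /sliced_sum esum1// => v _; exact: measure0. Qed.

Let sliced_sum_ge0 A : 0 <= sliced_sum A.
Proof. by apply: esum_ge0 => v _; exact: measure_ge0. Qed.

Let sliced_sum_sigma_additive : semi_sigma_additive sliced_sum.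
Proof.
move=> F mF tF mUF.
have mFv v i : measurable (slice v (F i)) by exact: mF.
have -> : sliced_sum (\bigcup_n F n) =
    limn (fun n => \sum_(0 <= i < n) sliced_sum (F i)).
  rewrite /sliced_sum.
  transitivity (\esum_(v in [set: V])
      limn (fun n => \sum_(0 <= i < n) mu v (slice v (F i)))).
    apply: eq_esum => v _; rewrite -measure_semi_bigcup//.
    - by move=> i j _ _ [t [? ?]]; apply: tF => //; exists (Some v, t).
    - exact: bigcupT_measurable.
  rewrite esum_lim.
  - congr (limn _); apply/funext => n; rewrite esum_sum//.
  - by move=> n i; apply: sume_ge0 => *; exact: measure_ge0.
  - by move=> v; apply: ereal_nondecreasing_series => i _ _; exact: measure_ge0.
apply: ereal_nondecreasing_is_cvgn.
by apply: ereal_nondecreasing_series => i _ _; exact: sliced_sum_ge0.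
Qed.

HB.instance Definition _ := isMeasure.Build _ _ _ sliced_sum
  sliced_sum0 sliced_sum_ge0 sliced_sum_sigma_additive.

(** The sum of slice integrals has the properties required by [ge0_integral_unique]; [esum_lim]
    takes care of the limits. *)
Lemma integral_sliced f : measurable_fun setT f -> (forall x, 0 <= f x) ->
  \int[sliced_sum]_x f x = \esum_(v in [set: V]) \int[mu v]_t f (Some v, t).
Proof.
move=> mf f0.
pose I (g : X -> \bar R) := \esum_(v in [set: V]) \int[mu v]_t g (Some v, t).
have int0 (g : X -> \bar R) v : (forall x, 0 <= g x) -> 0 <= \int[mu v]_t g (Some v, t).
  by move=> g0; exact: integral_ge0.
rewrite -/(I f); apply: ge0_integral_unique => //.
- move=> A mA; apply: eq_esum => v _.
  by rewrite -[slice v A]setIT -integral_indic//; exact: mA.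
- move=> k g k0 mg g0; rewrite /I -ge0_esumZl//; last by move=> v; exact: int0.
  apply: eq_esum => v _; rewrite ge0_integralZl_EFin//.
  exact: measurable_slice.
- move=> g h mg mh g0 h0; rewrite /I -esumD//; try by move=> v _; exact: int0.
  by apply: eq_esum => v _; rewrite ge0_integralD//; exact: measurable_slice.
- move=> g mg g0 gnd; rewrite /I -esum_lim.
  + apply: eq_esum => v _; rewrite monotone_convergence//.
    by move=> n; exact: measurable_slice.
  + by move=> n v; exact: int0.
  + move=> v m n mn; apply: ge0_le_integral => //; try exact: measurable_slice.
    by move=> t _; exact: gnd.
Qed.

End Sliced.

(** * The shift in [L^2] *)

Section ShiftExtension.
Context (R : realType) (V : choiceType) (par : V -> V) (lam : V -> R[i])
  (mu : V -> probability R R).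
Local Notation C := R[i].
Local Notation X := (sliced V R).
Local Notation M := (sliced_sum mu).

Hypothesis lam_neq0 : forall v, lam v != 0.
Hypothesis mu_neg : forall v, mu v [set t : R | t < 0] = 0%E.
Hypothesis mu_consistent : forall (u : V) (sigma : set R), measurable sigma ->
  sigma `<=` [set t | 0 <= t] ->
  mu u sigma = (\esum_(v in Chi par u)
                  ((csq (lam v))%:E * \int[mu v]_(t in sigma) inv_t t))%E.

Let inv_t_ge0 (t : R) : 0 <= t -> (0 <= inv_t t)%E.
Proof.
by rewrite /inv_t => t0; case: ifP => _; rewrite ?leey// lee_fin invr_ge0.
Qed.

(** Since 1/0 = oo and [lam v] is nonzero, positive mass of [mu v] at 0 would give its parent
    infinite mass there. *)
Lemma mu_set0 v : mu v [set 0] = 0%E.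
Proof.
apply/eqP; rewrite eq_le measure_ge0 andbT leNgt; apply/negP => pos.
have : (mu (par v) [set (0 : R)%R] < +oo)%E.
  by rewrite ltey_eq fin_num_measure.
rewrite mu_consistent; [|exact: measurable_set1|by move=> _ ->/=].
rewrite ltNge => /negP; apply; apply: esum_ge; exists [set v].
  by split; [exact: finite_set1|move=> _ ->].
rewrite fsbig_set1 (eq_integral (cst +oo%E)); last first.
  by move=> t /set_mem ->; rewrite /inv_t eqxx.
rewrite integral_cst; last exact: measurable_set1.
by rewrite gt0_mulye// gt0_muley// lte_fin csq_gt0.
Qed.

Lemma mu_pos v : {ae mu v, forall t, 0 < t}.
Proof.
exists ([set t | t < 0] `|` [set 0]); split.
- apply: measurableU; last exact: measurable_set1.
  by rewrite -set_itvNyo; exact: measurable_itv.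
- have m1 : measurable [set t : R | t < 0] by rewrite -set_itvNyo; exact: measurable_itv.
  exact: (null_set_setU m1 (measurable_set1 0) (mu_neg v) (mu_set0 v)).
- by move=> t /= /negP; rewrite -leNgt le_eqVlt => /orP[/eqP ->|]; [right|left].
Qed.


Let sq (t : R) : R := t `^ 2^-1.
Let isq (t : R) : R := t `^ (- 2^-1).

Let sq_isq t : 0 < t -> sq t * isq t = 1.
Proof. by move=> t0; rewrite /sq /isq powRN mulfV// gt_eqF// powR_gt0. Qed.

Let isq2 t : 0 < t -> isq t ^+ 2 = t^-1.
Proof.
move=> t0; rewrite -powR_mulrn ?powR_ge0// -powRrM.
by rewrite (_ : - 2^-1 * 2 = -1) ?powRN ?powRr1 ?ltW//; lra.
Qed.

(** [phi] moves a point to the slice of the parent and keeps t; [w] is the squared modulus of the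
    multiplier in U, so |U F|^2 = (|F|^2 o phi) w. *)
Let phi (x : X) : X := (omap par x.1, x.2).
Let lamx (x : X) : C := if x.1 is Some v then lam v else 0.
Let w (x : X) : R := csq (lamx x) * isq x.2 ^+ 2.

Let mphi : measurable_fun setT phi.
Proof.
apply: measurable_fun_sliced => v _ B mB; rewrite setTI.
exact: (mB (par v)).
Qed.


Let msnd : measurable_fun setT (fun x : X => x.2).
Proof. by apply: measurable_fun_sliced => v /=; exact: measurable_id. Qed.

Let misq : measurable_fun setT (fun x : X => isq x.2).
Proof. by apply: (measurableT_comp (measurable_powR _)). Qed.

Let msq : measurable_fun setT (fun x : X => sq x.2).
Proof. by apply: (measurableT_comp (measurable_powR _)). Qed.

Let mw : measurable_fun setT w.
Proof.
apply: measurable_funM; last exact: measurable_funX.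
by apply: measurable_fun_sliced => v; rewrite /lamx /=; exact: measurable_cst.
Qed.

Let w_ge0 x : 0 <= w x.
Proof. by rewrite mulr_ge0 ?csq_ge0 ?sqr_ge0. Qed.

(** The right-hand side is a summand of the consistency condition. The integrands agree on t > 0,
    which carries [mu v]. *)
Let integral_weight v (B : set R) : measurable B ->
  (\int[mu v]_t ((\1_B t)%:E * (csq (lam v) * isq t ^+ 2)%:E) =
   (csq (lam v))%:E * \int[mu v]_(t in B `&` [set t | 0 <= t]%R) inv_t t)%E.
Proof.
move=> mB.
have mnn : measurable [set t : R | 0 <= t].
  by rewrite -set_itvcy; exact: measurable_itv.
have misqR : measurable_fun setT (fun t : R => (\1_B t * isq t ^+ 2)%R).
  apply: measurable_funM; first exact: measurable_indic.
  by apply: measurable_funX; exact: measurable_powR.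
under eq_integral do rewrite -EFinM mulrCA EFinM.
rewrite ge0_integralZl_EFin ?csq_ge0//; last 2 first.
- by move=> t _; rewrite lee_fin mulr_ge0 ?sqr_ge0// indicE.
- exact/measurable_EFinP.
congr (_ * _)%E.
rewrite [RHS]integral_mkcond.
apply: ae_eq_integral => //; first exact/measurable_EFinP.
  apply: (measurable_restrictT _ (measurableI _ _ mB mnn)).1.
  apply: (@eq_measurable_fun _ _ _ _ _
      (fun t : R => if t == 0 then +oo%E else (t `^ (-1))%:E)) => [t|].
    by move=> /set_mem[_ /= t0]; rewrite powR_inv1.
  apply: measurable_funTS; apply: measurable_fun_ifT => //.
    by apply: measurable_fun_eqr => //; exact: measurable_cst.
  by apply/measurable_EFinP; exact: measurable_powR.
apply: filterS (mu_pos v) => t t0 _ /=.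
rewrite patchE indicE; case: ifPn => [/set_mem[Bt _]|].
  by rewrite mem_set// mul1r isq2// /inv_t gt_eqF.
rewrite notin_setE => h; rewrite memNset ?mul0r//.
by move=> Bt; apply: h; split=> //=; exact: ltW.
Qed.

(** By uniqueness of the integral only indicators matter; there the identity is the consistency
    condition summed over all vertices. *)
Lemma integral_shift (f : X -> \bar R) : measurable_fun setT f ->
  (forall x, (0 <= f x)%E) ->
  (\int[M]_x (f (phi x) * (w x)%:E) = \int[M]_x f x)%E.
Proof.
move=> mf f0; pose I (g : X -> \bar R) := (\int[M]_x (g (phi x) * (w x)%:E))%E.
have mnn : measurable [set t : R | 0 <= t].
  by rewrite -set_itvcy; exact: measurable_itv.
have mneg : measurable [set t : R | t < 0].
  by rewrite -set_itvNyo; exact: measurable_itv.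
have mI (g : X -> \bar R) : measurable_fun setT g ->
    measurable_fun setT (fun x => g (phi x) * (w x)%:E)%E.
  move=> mg; apply: emeasurable_funM; last exact/measurable_EFinP.
  exact: (measurableT_comp mg mphi).
rewrite -/(I f); symmetry; apply: ge0_integral_unique => //.
- move=> A mA; have mS v : measurable (slice v A) by exact: (mA : sliced_measurable A).
  rewrite /I integral_sliced; last 2 first.
  + apply: (mI (fun x => (\1_A x)%:E)); apply/measurable_EFinP.
    exact: measurable_indic.
  + by move=> x; rewrite mule_ge0// lee_fin.
  (* The sum over all vertices v is grouped by parent, through the bijection of v with the pair (par
     v, v). *)
  transitivity (\esum_(u in [set: V]) \esum_(v in Chi par u)
      ((csq (lam v))%:E * \int[mu v]_(t in slice u A `&` [set t | 0 <= t]%R) inv_t t))%E.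
    rewrite esum_esum; last first.
      move=> u v _ _; rewrite mule_ge0 ?lee_fin ?csq_ge0// integral_ge0// => t [_].
      exact: inv_t_ge0.
    rewrite (@reindex_esum _ _ _ setT _ (fun v => (par v, v))).

      apply: eq_esum => v _; rewrite -integral_weight//; exact: mS.
    split=> [v _|v v' _ _ []//|[u v] [_ /= <-]]; first by split.
    by exists v.
  apply: eq_esum => u _; rewrite -mu_consistent.
  (* Consistency concerns only subsets of t >= 0; the rest of the slice is null. *)
  + rewrite [in RHS](_ : slice u A = (slice u A `&` [set t | 0 <= t]) `|`
        (slice u A `&` [set t | t < 0])); last first.
      rewrite -setIUr [X in _ `&` X](_ : _ = setT) ?setIT//.
      apply/seteqP; split=> // t _ /=.
      by case: (leP 0 t) => ?; [left|right].
    symmetry; apply: measureU0; [exact: measurableI _ _ (mS u) mnn|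
      exact: measurableI _ _ (mS u) mneg|].
    by apply: (subset_measure0 (measurableI _ _ (mS u) mneg) mneg) => //; exact: mu_neg.
  + exact: measurableI _ _ (mS u) mnn.
  + by move=> t [].
- move=> k g k0 mg g0; rewrite /I.
  under eq_integral do rewrite -muleA.
  rewrite ge0_integralZl_EFin//; last exact: mI.
  by move=> x _; rewrite mule_ge0// lee_fin.
- move=> g h mg mh g0 h0; rewrite /I.
  under eq_integral do rewrite ge0_muleDl//.
  rewrite ge0_integralD//; try exact: mI;
    by move=> x _; rewrite mule_ge0// lee_fin.
- move=> g mg g0 gnd; rewrite /I -monotone_convergence//.
  + apply: eq_integral => x _; symmetry; apply/cvg_lim => //.
    by apply: cvgeZr => //; exact: ereal_nondecreasing_is_cvgn.
  + by move=> n; exact: mI.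
  + by move=> n x _; rewrite mule_ge0// lee_fin.
  + by move=> x _ m n mn; rewrite lee_wpmul2r// ?lee_fin// gnd.
Qed.


Lemma sliced_ae_pos : {ae M, forall x, x.1 != None -> 0 < x.2}.
Proof.
pose N : set X := [set x | x.1 != None /\ x.2 <= 0].
have sN v : slice v N = [set t | t <= 0] by apply/seteqP; split=> t //= [].
have mneg : measurable [set t : R | t <= 0].
  by rewrite -set_itvNyc; exact: measurable_itv.
exists N; split.
- by rewrite -[measurable _]/(sliced_measurable _) => v; rewrite sN.
- apply: esum1 => v _; rewrite sN; have [B [mB B0 sB]] := mu_pos v.
  apply: (subset_measure0 mneg mB) => // t /= t0; apply: sB => /=.
  by apply/negP; rewrite -leNgt.
- move=> x /= /not_implyP[x1 /negP]; rewrite -leNgt => x2; split=> //.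
Qed.

Let shift_fun (F : X -> C) (x : X) : C := lamx x * (isq x.2)%:C%C * F (phi x).

Let csq_shift F x : csq (shift_fun F x) = csq (F (phi x)) * w x.
Proof. by rewrite /shift_fun !csqM csqR mulrC. Qed.

Let cmeasurable_phi (F : X -> C) : cmeasurable F -> cmeasurable (fun x => F (phi x)).
Proof.
move=> [mr mi]; split; first exact: (measurableT_comp mr mphi).
exact: (measurableT_comp mi mphi).
Qed.

Let cmeasurable_vertex (f : option V -> C) : cmeasurable (fun x : X => f x.1).
Proof. by split; apply: measurable_fun_sliced => v /=; exact: measurable_cst. Qed.

(** Infinite values are included, which [A_incl] relies on. *)
Let l2norm_shift F : cmeasurable F -> l2norm M (shift_fun F) = l2norm M F.
Proof.
move=> mF; rewrite /l2norm.
rewrite -(integral_shift (measurable_csq mF)) => [|x]; last by rewrite lee_fin csq_ge0.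
by apply: eq_integral => x _; rewrite csq_shift EFinM.
Qed.

Let l2_shift F : l2fun M F -> l2fun M (shift_fun F).
Proof.
move=> [mF fF]; split; last by rewrite l2norm_shift.
apply: cmeasurableM; last exact: cmeasurable_phi.
apply: cmeasurableM; last exact: cmeasurable_real.
exact: (cmeasurable_vertex (fun o => if o is Some v then lam v else 0)).
Qed.

Let UT (F : L2T M) : L2T M := mkL2 (l2_shift (L2P F)).

Let UT_linear (c : C) F G : UT (c *: F + G) = c *: UT F + UT G.
Proof.
apply: val_inj; apply/funext => x.
rewrite [LHS](_ : _ = lamx x * (isq x.2)%:C%C * (c * val F (phi x) + val G (phi x)))//.
by rewrite mulrDr [_ * (c * _)]mulrCA.
Qed.

Let UTB F G : UT (F - G) = UT F - UT G.
Proof.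
have := UT_linear (-1) G F; rewrite !scaleN1r => E.
by rewrite (addrC F (- G)) E (addrC (- UT G)).
Qed.

(** Norm preservation sends null functions to null functions, so the map descends to classes. *)
Let UT_eq F G : l2class F = l2class G -> l2class (UT F) = l2class (UT G).
Proof.
move=> FG; apply/eqP; rewrite -subr_eq0 -l2classB -UTB; apply/eqP.
apply: (hn_eq0 (L2_hilbert M)); apply: EFin_inj.
have [mFG _] := L2P (F - G).
rewrite hn_l2class (l2norm_shift mFG) -hn_l2class l2classB FG subrr.
by rewrite (hn0 (L2_hilbert M)).
Qed.

Let rep (p : L2 M) : L2T M := projT1 (cid (l2classP p)).
Let repK p : p = l2class (rep p). Proof. exact: projT2 (cid (l2classP p)). Qed.

Let U (p : L2 M) : L2 M := l2class (UT (rep p)).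

Let UE F : U (l2class F) = l2class (UT F).
Proof. by apply: UT_eq; rewrite -repK. Qed.

Let U_linear (c : C) p q : U (c *: p + q) = c *: U p + U q.
Proof.
by rewrite [p]repK [q]repK -l2class_linear !UE UT_linear l2class_linear.
Qed.

Let U_iso p : hn (@L2ip _ _ _ M) (U p) = hn (@L2ip _ _ _ M) p.
Proof.
apply: EFin_inj; rewrite [p]repK UE !hn_l2class l2norm_shift//.
by have [] := L2P (rep p).
Qed.

Let A : set (L2 M * L2 M) := mult_op (fun x : X => sq x.2).

(** [phi] leaves t unchanged, so multiplication by a function of t commutes with U. *)
Let AU p q : A (p, q) -> A (U p, U q).
Proof.
move=> [F [G [+ + FG]]] => /= -> ->.
exists (UT F), (UT G); split; rewrite ?UE// => x.
have UTE H : val (UT H) x = lamx x * (isq x.2)%:C%C * val H (phi x) by [].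
by rewrite !UTE FG mulrCA.
Qed.

(** * The embedding of l^2(V) and the action of the shift *)

Let incl (f : V -> C) (x : X) : C := if x.1 is Some v then f v else 0.

Let cmeasurable_incl f : cmeasurable (incl f).
Proof. exact: (cmeasurable_vertex (fun o => if o is Some v then f v else 0)). Qed.

Let l2norm_incl f : l2norm M (incl f) = l2sq f.
Proof.
rewrite /l2norm integral_sliced; last 2 first.
- exact: measurable_csq.
- by move=> x; rewrite lee_fin csq_ge0.
apply: eq_esum => v _; rewrite (eq_integral (cst (csq (f v))%:E))//.
by rewrite integral_cst// [X in (_ * X)%E](probability_setT (mu v)) mule1.
Qed.

Let l2_incl f : in_l2 f -> l2fun M (incl f).
Proof. by move=> hf; split=> //; rewrite l2norm_incl. Qed.

(* Stated for a variable measure because the filter instance of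
   [almost_everywhere] is not inferred for the concrete measure [M]. *)
Let ae_mono (m : {measure set X -> \bar R}) (P Q : X -> Prop) :
  (forall x, P x -> Q x) -> {ae m, forall x, P x} -> {ae m, forall x, Q x}.
Proof. by move=> PQ; apply: filterS. Qed.

Let shift_sq_incl f : {ae M, forall x,
  shift_fun (fun x => (sq x.2)%:C%C * incl f x) x = incl (Lam par lam f) x}.
Proof.
apply: (ae_mono _ sliced_ae_pos) => -[[v|] t] /=; last first.
  by move=> _; rewrite /shift_fun /lamx /= !mul0r.
move=> /(_ isT) t0; rewrite /shift_fun /lamx /incl /Lam /=.
have e : (isq t)%:C%C * (sq t)%:C%C = 1 by rewrite -rmorphM/= mulrC sq_isq.
by rewrite -mulrA (mulrA (isq t)%:C%C) e mul1r.
Qed.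

(** The value 0 outside l^2(V) is a default, since [J] is total; the second component 0 places the
    embedding in the first summand of the dilation space. *)
Let J (f : V -> C) : L2 M * L2 M :=
  if pselect (in_l2 f) is left hf then (l2class (mkL2 (l2_incl hf)), 0) else 0.

Let JE f (hf : l2fun M (incl f)) : J f = (l2class (mkL2 hf), 0).
Proof.
rewrite /J; case: pselect => [hf'|nf].
  by congr (l2class _, _); exact: val_inj.
by exfalso; apply: nf; rewrite /in_l2 -l2norm_incl; case: hf.
Qed.

(** U maps t^(1/2) f to Lam f almost everywhere and preserves even infinite norms, so t^(1/2) f has
    the finite norm of Lam f and f lies in the domain of [A]. *)
Let A_incl f (hL : l2fun M (incl (Lam par lam f))) (hf : l2fun M (incl f)) :
  exists2 q, A (l2class (mkL2 hf), q) & U q = l2class (mkL2 hL).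
Proof.
pose F (x : X) : C := (sq x.2)%:C%C * incl f x.
have mF : cmeasurable F by apply: cmeasurableM => //; exact: cmeasurable_real.
have [mL fL] := hL.
have mS : cmeasurable (shift_fun F).
  apply: cmeasurableM; last exact: cmeasurable_phi.
  apply: cmeasurableM; last exact: cmeasurable_real.
  exact: (cmeasurable_vertex (fun o => if o is Some v then lam v else 0)).
have lF : l2fun M F.
  by split=> //; rewrite -l2norm_shift// (ae_eq_l2norm mS mL (shift_sq_incl f)).
exists (l2class (mkL2 lF)); first by exists (mkL2 hf), (mkL2 lF).
by rewrite UE; apply/l2class_eq; exact: shift_sq_incl.
Qed.

Lemma consistent_shift_subnormal : subnormal_shift par lam.
Proof.
have [G Gn GA] := isometry_mul_selfadjoint_subnormal (L2_hilbert M) U_linear U_iso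
  (mult_op_linear M _) (@mult_op_single_valued _ _ _ M _) (mult_op_dense msq)
  (mult_op_selfadjoint M msq) AU.
exists (L2 M * L2 M)%type, (ip2 (@L2ip _ _ _ M)), J, G; split=> //.
- exact/ip2_hilbert/L2_hilbert.
- split=> [a f g hf hg|f hf]; last first.
    rewrite (JE (l2_incl hf)) hn_ip2 /= (hn0 (L2_hilbert M)) addr0 hn_l2class.
    exact: l2norm_incl.
  have lfg : l2fun M (incl (fun v => a * f v + g v)).
    have := l2funD (l2funZ a (l2_incl hf)) (l2_incl hg); congr l2fun.
    by apply/funext => -[[v|] t]; rewrite /incl /= ?mulr0 ?addr0.
  rewrite (JE lfg) (JE (l2_incl hf)) (JE (l2_incl hg)); congr pair; last first.
    by rewrite /= scaler0 addr0.
  rewrite -l2class_linear; congr l2class; apply: val_inj; apply/funext => x.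
  rewrite [RHS](_ : _ = a * incl f x + incl g x)//=.
  by case: x => [[v|] t]; rewrite /incl /= ?mulr0 ?addr0.
- move=> f [hf hL]; rewrite (JE (l2_incl hf)) (JE (l2_incl hL)).
  have [q Aq <-] := A_incl (l2_incl hL) (l2_incl hf).
  exact: GA.
Qed.

End ShiftExtension.

Unset Implicit Arguments.

Theorem theorem47 (R : realType) (V : choiceType) (par : V -> V) (lam : V -> R[i])
    (mu : V -> probability R R) :
  directed_tree par -> leafless par ->
  densely_defined_shift par lam ->
  (forall v, lam v != 0) ->
  (forall v, mu v [set t : R | t < 0] = 0%E) ->
  (forall (u : V) (sigma : set R), measurable sigma -> sigma `<=` [set t | 0 <= t] ->
     mu u sigma = (\esum_(v in Chi par u)
                     ((csq (lam v))%:E * \int[mu v]_(t in sigma) inv_t t))%E) ->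
  subnormal_shift par lam.
Proof.
move=> _ _ _ lam0 mu_neg mu_cons.
exact: consistent_shift_subnormal lam0 mu_neg mu_cons.
Qed.
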